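(* Let $0<\epsilon<10^{-3}$ and let $k\geq 2$ be an integer. Let $(X,Y,Z,A,\phi)$ be a partial Latin square with $|X|=|Y|=|Z|=n$ containing at least $\epsilon n^5$ octahedra. Then there is a subset $B\subset A$ with $|B|=\beta n^2$, $\beta\geq \epsilon^{10}$, such that for each $2\leq r\leq k$ the $2r$-cycle completion operation in $B$ is $\epsilon^{-33k^3}$-well-defined.
   Context: A partial Latin square is $(X,Y,Z,A,\phi)$ with $A\subset X\times Y$ and $\phi:A\to Z$ injective in each variable separately; cells $(x,y)\in A$ lie in column $x$, row $y$ and carry label $\phi(x,y)$. An octahedron is a tuple $(x_1,x_2,y_1,y_2,x_3,x_4,y_3,y_4)$ with the cells $(x_i,y_j)$ for $i,j\in\{1,2\}$ and for $i,j\in\{3,4\}$ in $A$ and $\phi(x_1,y_1)=\phi(x_3,y_3)$, $\phi(x_2,y_1)=\phi(x_4,y_3)$, $\phi(x_1,y_2)=\phi(x_3,y_4)$, $\phi(x_2,y_2)=\phi(x_4,y_4)$ (degeneracies allowed). A (label) $2r$-cycle in $B$ is a sequence of cells $p_1,\dots,p_{2r}\in B$ such that $p_i$ and $p_{i+1}$ lie in the same row when $i$ is odd and in the same column when $i$ is even (with $p_{2r}$ and $p_1$ in the same column); its label sequence is $(\phi(p_1),\dots,\phi(p_{2r}))$. The $2r$-cycle completion operation in $B$ sends $(z_1,\dots,z_{2r-1})$ to $z_{2r}$ whenever $(z_1,\dots,z_{2r})$ is the label sequence of some $2r$-cycle in $B$; it is $C$-well-defined if for every $(z_1,\dots,z_{2r-1})$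 the number of such $z_{2r}$ is at most $C$. *)

(* Defs.v *)
From HB Require Import structures.
From mathcomp Require Import all_boot all_order all_algebra.
From mathcomp Require Import reals.
Set Implicit Arguments.
Unset Strict Implicit.
Unset Printing Implicit Defensive.
Import Order.TTheory GRing.Theory Num.Theory.
Local Open Scope ring_scope.

(* A labelling A -> Z is given by a total function phi : X * Y -> Z whose
   values outside A are never used. Every labelling of A extends to such a
   phi when #|X| = #|Y| = #|Z|: if Z is empty then so is X * Y. *)
Definition partial_latin_square (X Y Z : finType) (A : {set X * Y})
    (phi : X * Y -> Z) : Prop :=
  (forall x x' y, (x, y) \in A -> (x', y) \in A ->
     phi (x, y) = phi (x', y) -> x = x') /\
  (forall x y y', (x, y) \in A -> (x, y') \in A ->
     phi (x, y) = phi (x, y') -> y = y').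

(* The tuple is (x1, x2, y1, y2, x3, x4, y3, y4). *)
Definition octahedra (X Y Z : finType) (A : {set X * Y}) (phi : X * Y -> Z) :
    {set X * X * Y * Y * X * X * Y * Y} :=
  [set t | let: (x1, x2, y1, y2, x3, x4, y3, y4) := t in
    [&& (x1, y1) \in A, (x1, y2) \in A, (x2, y1) \in A, (x2, y2) \in A,
        (x3, y3) \in A, (x3, y4) \in A, (x4, y3) \in A, (x4, y4) \in A,
        phi (x1, y1) == phi (x3, y3), phi (x2, y1) == phi (x4, y3),
        phi (x1, y2) == phi (x3, y4) & phi (x2, y2) == phi (x4, y4)]].

(* Cells are numbered from 0, so that the cell called p_i on paper has index
   i - 1: even indices share their row (second coordinate) with the next cell,
   odd indices their column (first coordinate). ordS is the cyclic successor,
   so index 2r - 1 is followed by index 0. *)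
Definition is_cycle (X Y : finType) (B : {set X * Y}) (r : nat)
    (p : (2 * r).-tuple (X * Y)) : bool :=
  [forall i : 'I_(2 * r),
    (tnth p i \in B) &&
    (if odd i then (tnth p i).1 == (tnth p (ordS i)).1
     else (tnth p i).2 == (tnth p (ordS i)).2)].

Definition cycle_completions (X Y Z : finType) (phi : X * Y -> Z)
    (B : {set X * Y}) (r : nat) (z : (2 * r).-1.-tuple Z) : {set Z} :=
  [set w | [exists p : (2 * r).-tuple (X * Y),
              is_cycle B p && (map phi p == rcons z w)]].

Definition completion_well_defined (R : realType) (X Y Z : finType)
    (phi : X * Y -> Z) (B : {set X * Y}) (r : nat) (C : R) : Prop :=
  forall z : (2 * r).-1.-tuple Z, #|cycle_completions phi B z|%:R <= C.

(* Main.v *)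
Require Import Defs.
From HB Require Import structures.
From mathcomp Require Import all_boot all_order all_algebra.
From mathcomp Require Import reals.
From mathcomp Require Import zify ring lra.
Set Implicit Arguments.
Unset Strict Implicit.
Unset Printing Implicit Defensive.
Import Order.TTheory GRing.Theory Num.Theory.
Local Open Scope ring_scope.

(** View the square as a properly edge-coloured bipartite graph on [X + Y], the
    label of a cell being the colour of an edge. Call a rectangle popular if its
    label sequence is shared by at least [eps * n / 2] rectangles; three labels of
    a popular rectangle leave at most [2 / eps] choices for the fourth, and the
    octahedra force [eps / 2 * n ^ 4] popular rectangles.

    For a pivot [q = (u, v)] let [B_q] be the set of cells [(x, y)] that span a
    popular rectangle with [q]. If all edges of a closed walk lie in [B_q] for at
    least [delta * n ^ 2] pivots (a rich walk), then its last label is determined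
    by the others up to [(2 / eps) ^ length / delta] choices: guess the label of
    [q] and of one spoke, and go around the walk one popular rectangle at a time.

    By dependent random choice some [B := B_q] is dense while almost all hexagons
    and almost all long closed walks in [B] are rich. Delete from [B] the few
    edges [yx] for which the endpoints have small degree, or for which many pairs
    of neighbours [a] of [y] and [b] of [x] have few paths [a c d b] completing a
    rich hexagon [y a c d b x]. A closed walk [v_0 ... v_(m-1)] of remaining edges
    then has at least a constant proportion of [#|V| ^ (3 m)] extensions: spokes
    [v_i s_i] and paths [s_i c_i d_i s_(i+1)] such that every hexagon on an edge
    [v_i v_(i+1)] is rich and so is the inner walk [s_0 c_0 d_0 s_1 ...]. The
    labels of an extension determine it. Going around the walk through the
    hexagons bounds the number of possible labels of all extensions, for given
    labels of [m - 1] edges of the walk, by a constant times [#|V| ^ (3 m)]; hence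
    the last label takes boundedly many values. *)

(** * Double counting of pairs *)

Lemma leq_card_bigcup (I T : finType) (A : {set I}) (F : I -> {set T}) :
  (#|\bigcup_(i in A) F i| <= \sum_(i in A) #|F i|)%N.
Proof.
elim/big_ind2: _ => [|m S m' S' le1 le2|//]; first by rewrite cards0.
by apply: leq_trans (leq_card_setU _ _) (leq_add _ _).
Qed.

Lemma card_pairs (S T : finType) (P : S -> pred T) :
  #|[set p : S * T | P p.1 p.2]| = (\sum_a #|[set b | P a b]|)%N.
Proof.
rewrite -sum1_card.
under eq_bigl do rewrite inE.
rewrite -(pair_big_dep predT P (fun _ _ => 1%N)) /=.
by apply: eq_bigr => a _; rewrite -sum1_card; apply: eq_bigl => b; rewrite inE.
Qed.

Lemma card_pairsC (S T : finType) (P : S -> T -> bool) :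
  (\sum_a #|[set b | P a b]| = \sum_b #|[set a | P a b]|)%N.
Proof.
rewrite (eq_bigr (fun a => \sum_(b | P a b) 1)%N); last first.
  by move=> a _; rewrite -sum1_card; apply: eq_bigl => b; rewrite inE.
rewrite (exchange_big_dep predT) //=; apply: eq_bigr => b _.
by rewrite -sum1_card; apply: eq_bigl => a; rewrite inE.
Qed.

Lemma card_dep_pairs_ge (R : realType) (S T : finType) (W : {set S})
    (F : S -> {set T}) (K : R) :
  (forall a, a \in W -> K <= #|F a|%:R) ->
  #|W|%:R * K <= #|[set p : S * T | (p.1 \in W) && (p.2 \in F p.1)]|%:R.
Proof.
move=> hF; rewrite (card_pairs (fun a b => (a \in W) && (b \in F a))).
rewrite natr_sum (bigID (mem W)) /= -[leLHS]addr0.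
apply: lerD; last exact: sumr_ge0.
rewrite mulr_natl -sumr_const; apply: ler_sum => a aW.
apply: le_trans (hF a aW) _; rewrite ler_nat; apply/subset_leq_card/subsetP => b hb.
by rewrite inE aW.
Qed.

(** * States reachable in a given number of steps *)

Section Reach.
Variables (S : finType) (R : nat -> rel S).

(** The relation may change with the step. In use the states are labels, and crossing one rectangle
    or hexagon leaves boundedly many possibilities for the next label. *)
Fixpoint reach (s0 : S) (m : nat) : {set S} :=
  if m is m'.+1 then \bigcup_(s in reach s0 m') [set t | R m' s t]
  else [set s0].

Lemma card_reach (D : nat) (s0 : S) (m : nat) :
  (forall e s, (#|[set t | R e s t]| <= D)%N) -> (#|reach s0 m| <= D ^ m)%N.
Proof.
move=> hD; elim: m => [|m IH] /=; first by rewrite cards1 expn0.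
apply: leq_trans (leq_card_bigcup _ _) _.
apply: (@leq_trans (\sum_(i in reach s0 m) D)%N).
  by apply: leq_sum => i _; apply: hD.
by rewrite sum_nat_const expnSr leq_mul2r IH orbT.
Qed.

Lemma mem_reach (s : nat -> S) (m : nat) :
  (forall e, (e < m)%N -> R e (s e) (s e.+1)) -> s m \in reach (s 0%N) m.
Proof.
elim: m => [|m IH] h /=; first by rewrite inE.
apply/bigcupP; exists (s m); last by rewrite inE h.
by apply: IH => e he; apply: h; apply: ltnW.
Qed.

End Reach.

(** * Encoding of the inner walks *)

Section Configurations.
Variables (V : finType) (M : nat).
Local Notation m := M.+1.

(* [(s, f)] with [f i = (c_i, d_i)] encodes the walk s_0 c_0 d_0 s_1 c_1 d_1 ...,
   indices being taken modulo [m]. *)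
Definition config := ({ffun 'I_m -> V} * {ffun 'I_m -> V * V})%type.

Definition inner (t : config) (j : nat) : V :=
  let i := inZp (j %/ 3) in
  match (j %% 3)%N with 0%N => t.1 i | 1%N => (t.2 i).1 | _ => (t.2 i).2 end.

Lemma inner0 t e : inner t (3 * e) = t.1 (inZp e).
Proof. by rewrite /inner modnMr mulKn. Qed.
Lemma inner1 t e : inner t (3 * e).+1 = (t.2 (inZp e)).1.
Proof.
rewrite /inner -addn1 mulnC.
by rewrite modnMDl divnMDl // addn0.
Qed.
Lemma inner2 t e : inner t (3 * e).+2 = (t.2 (inZp e)).2.
Proof.
rewrite /inner -addn2 mulnC.
by rewrite modnMDl divnMDl // addn0.
Qed.
Lemma inner3 t e : inner t (3 * e).+3 = t.1 (inZp e.+1).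
Proof. by rewrite -addn3 -mulnSr inner0. Qed.

(** [L.+1] is [3 * m], the length of the inner walk, so [L] is the index of its last edge. *)
Local Notation L := (3 * M).+2.

Lemma inner_closed t : inner t L.+1 = inner t 0.
Proof.
rewrite inner3 -[0%N in RHS](muln0 3) inner0; congr (t.1 _).
by apply: val_inj; rewrite /= modnn mod0n.
Qed.

Lemma config_eq (t t' : config) :
  (forall j, (j < L.+1)%N -> inner t j = inner t' j) -> t = t'.
Proof.
move=> h; case: t t' h => [s c] [s' c'] h; congr (_, _); apply/ffunP => i.
all: have hi : (i <= M)%N := ltn_ord i.
  have := h (3 * i)%N; rewrite !inner0 /= valZpK; apply; lia.
have := h (3 * i).+1; have := h (3 * i).+2.
rewrite !inner1 !inner2 /= valZpK => h2 h1.
by apply: injective_projections; [apply: h1 | apply: h2]; lia.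
Qed.

End Configurations.

(** * Averaging over pivots *)

(** Exchange the sums: an object [t] incident to fewer than [P] of the [q] is counted fewer than [P]
    times, any other not at all. *)
Lemma sum_poor (R : realType) (Q T : finType) (I : Q -> T -> bool) (P : R) :
  0 <= P ->
  \sum_q #|[set t | I q t && (#|[set q' | I q' t]|%:R < P)]|%:R <= #|T|%:R * P.
Proof.
move=> P0; rewrite -natr_sum.
rewrite (card_pairsC (fun q t => I q t && (#|[set q' | I q' t]|%:R < P))) natr_sum.
rewrite mulr_natl -sumr_const; apply: ler_sum => t _.
case: (ltP (#|[set q' | I q' t]|%:R) P) => hP.
  apply: le_trans (ltW hP); rewrite ler_nat; apply/subset_leq_card/subsetP=> q.
  by rewrite !inE andbT.
by rewrite (_ : [set _ | _] = set0) ?cards0 //; apply/setP=> q; rewrite !inE andbF.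
Qed.

(** The mean of [f - g1 - g2] is at least [e / 4 - 2 * e ^+ 2 > e / 8]; where the value is at least
    [e / 8], [f <= 1] forces [g1] and [g2] below 1. In use, [f] is an edge density and [g1], [g2]
    count poor objects relative to the number tolerated. *)
Lemma exists_good_pivot (R : realType) (Q : finType) (e : R) (f g1 g2 : Q -> R) :
  (0 < #|Q|)%N -> 0 < e -> e < 10 ^- 3 ->
  (forall q, f q <= 1) -> (forall q, 0 <= g1 q) -> (forall q, 0 <= g2 q) ->
  e / 4 * #|Q|%:R <= \sum_q f q ->
  \sum_q g1 q <= e ^+ 2 * #|Q|%:R -> \sum_q g2 q <= e ^+ 2 * #|Q|%:R ->
  exists q, [/\ e / 8 <= f q, g1 q <= 1 & g2 q <= 1].
Proof.
move=> Q0 e0 e1 hf hg1 hg2 hF hG1 hG2.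
case: (pickP (fun q => e / 8 <= f q - g1 q - g2 q)) => [q hq|hno].
  by exists q; have := hf q; have := hg1 q; have := hg2 q; split; lra.
have : \sum_q (f q - g1 q - g2 q) <= \sum_(q : Q) e / 8.
  by apply: ler_sum => q _; apply: ltW; rewrite ltNge hno.
rewrite !sumrB sumr_const -[_ *+ _]mulr_natr => h.
have Qp : 0 < #|Q|%:R :> R by rewrite ltr0n.
have : 10 ^- 3 = 1 / 1000 :> R by field.
move=> h3; rewrite h3 in e1.
have : e ^+ 2 * #|Q|%:R <= e / 1000 * #|Q|%:R.
  by apply: ler_wpM2r; [exact: ltW|rewrite expr2; nra].
have : 0 < e * #|Q|%:R by apply: mulr_gt0.
lra.
Qed.

(** * Deleting the bad edges of a graph *)

Section Cleaning.
Variables (R : realType) (V : finType) (B : rel V).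
Variables (H : {set V * V * V * V * V * V}) (e K K' : R).
Local Notation N := (#|V|%:R : R).
Hypothesis B_sym : forall v w, B v w = B w v.

Definition paths3 (a b : V) : {set V * V} :=
  [set p | [&& B a p.1, B p.1 p.2 & B p.2 b]].

Definition good_paths (y x a b : V) : {set V * V} :=
  [set p in paths3 a b | (y, a, p.1, p.2, b, x) \notin H].

Definition deficient (y x a b : V) : bool :=
  #|good_paths y x a b|%:R < K * N ^+ 2.

Definition deficient_pairs (y x : V) : {set V * V} :=
  [set p | [&& B y p.1, B x p.2 & deficient y x p.1 p.2]].

Definition kept (y x : V) : bool :=
  [&& B y x, e ^+ 2 * N <= #|[set a | B y a]|%:R,
      e ^+ 2 * N <= #|[set b | B x b]|%:R
    & #|deficient_pairs y x|%:R <= K' * N ^+ 2].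

Hypothesis card_H : #|H|%:R <= K ^+ 2 * N ^+ 6.
Hypothesis K_gt0 : 0 < K.
Hypothesis N_gt0 : 0 < N.

(** A deficient pair has either fewer than [2 * K * N ^+ 2] paths in all ([c1]), or at least
    [K * N ^+ 2] choices of middle vertices giving a hexagon in [H] ([c2]). By the bound on [H], the
    second case occurs at most [K * N ^+ 4] times. *)
Lemma card_deficient_total :
  \sum_(p : V * V) #|[set p' | [&& B p.1 p.2, B p.1 p'.1, B p.2 p'.2
      & deficient p.1 p.2 p'.1 p'.2]]|%:R <= 3 * K * N ^+ 4.
Proof.
pose bad (p p' : V * V) := #|[set q : V * V | (p.1, p'.1, q.1, q.2, p'.2, p.2) \in H]|%:R : R.
pose c1 (p p' : V * V) := [&& B p.1 p.2, B p.1 p'.1, B p.2 p'.2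
  & #|paths3 p'.1 p'.2|%:R < 2 * K * N ^+ 2].
pose c2 (p p' : V * V) := K * N ^+ 2 <= bad p p'.
apply: (@le_trans _ _ (\sum_(p : V * V)
    (#|[set p' | c1 p p']|%:R + #|[set p' | c2 p p']|%:R))).
  apply: ler_sum => p _; rewrite -natrD ler_nat.
  apply: leq_trans (leq_card_setU _ _); apply/subset_leq_card/subsetP => p'.
  rewrite !inE /c1 => /and4P[-> -> -> hd] /=.
  case: ltP => //= h1; rewrite /c2 /bad.
  have : (#|paths3 p'.1 p'.2| <= #|good_paths p.1 p.2 p'.1 p'.2|
      + #|[set q : V * V | (p.1, p'.1, q.1, q.2, p'.2, p.2) \in H]|)%N.
    apply: leq_trans (leq_card_setU _ _); apply/subset_leq_card/subsetP => q.
    by rewrite !inE => -> /=; case: (_ \in H).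
  rewrite -(ler_nat R) natrD; move: hd; rewrite /deficient; lra.
rewrite big_split /=.
have h1 : \sum_p #|[set p' | c1 p p']|%:R <= 2 * K * N ^+ 4.
  rewrite -natr_sum card_pairsC natr_sum.
  have -> : 2 * K * N ^+ 4 = \sum_(p : V * V) (2 * K * N ^+ 2).
    by rewrite sumr_const -[RHS]mulr_natr card_prod natrM; ring.
  apply: ler_sum => p' _; case: (ltP (#|paths3 p'.1 p'.2|%:R) (2 * K * N ^+ 2)) => hP.
    (* For [p' = (a, b)], an edge [(y, x)] with [y] adjacent to [a] and [x] to [b] is itself the
       middle of a path from [a] to [b], so there are no more such edges than paths. *)
    apply: le_trans (ltW hP); rewrite ler_nat; apply/subset_leq_card/subsetP => p.
    by rewrite !inE => /and4P[-> h -> _]; rewrite B_sym h.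
  rewrite (_ : [set _ | _] = set0) ?cards0; last first.
    by apply/setP=> p; rewrite !inE /c1 ltNge hP !andbF.
  by rewrite !mulr_ge0 ?exprn_ge0 // ltW.
have h2 : \sum_p #|[set p' | c2 p p']|%:R <= K * N ^+ 4.
  have KN : 0 < K * N ^+ 2 by rewrite mulr_gt0 ?exprn_gt0.
  rewrite -(ler_pM2r KN); apply: (@le_trans _ _ (#|H|%:R)); last first.
    by apply: le_trans card_H _; rewrite le_eqVlt; apply/orP; left; apply/eqP; ring.
  apply: (@le_trans _ _ (\sum_p \sum_p' bad p p')).
    rewrite mulr_suml; apply: ler_sum => p _.
    rewrite mulr_natl -sumr_const big_mkcond /=; apply: ler_sum => p' _.
    by rewrite inE; case: ifP => // _; apply: ler0n.
  under eq_bigr do rewrite -natr_sum.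
  rewrite -natr_sum ler_nat.
  rewrite (eq_bigr (fun p : V * V => #|[set t : (V * V) * (V * V) |
     (p.1, t.1.1, t.2.1, t.2.2, t.1.2, p.2) \in H]|)); last first.
    by move=> p _; rewrite (card_pairs (fun p' q => (p.1, p'.1, q.1, q.2, p'.2, p.2) \in H)).
  rewrite -(card_pairs (fun (p : V * V) (t : (V * V) * (V * V)) =>
    (p.1, t.1.1, t.2.1, t.2.2, t.1.2, p.2) \in H)).
  pose f (t : (V * V) * ((V * V) * (V * V))) :=
    (t.1.1, t.2.1.1, t.2.2.1, t.2.2.2, t.2.1.2, t.1.2).
  have f_inj : injective f.
    by move=> [[? ?] [[? ?] [? ?]]] [[? ?] [[? ?] [? ?]]] [-> -> -> -> -> ->].
  rewrite -(card_imset _ f_inj); apply/subset_leq_card/subsetP => _ /imsetP[t ht ->].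
  by move: ht; rewrite inE.
have : 0 <= K * N ^+ 4 by rewrite mulr_ge0 ?exprn_ge0 ?ltW.
lra.
Qed.

Hypothesis K'_gt0 : 0 < K'.
Hypothesis KE : K = e ^+ 2 * K'.

(** A low degree at either end accounts for [e ^+ 2 * N ^+ 2] edges each. By Markov's inequality at
    most [3 * K * N ^+ 4 / (K' * N ^+ 2) = 3 * e ^+ 2 * N ^+ 2] edges have too many deficient
    pairs. *)
Lemma card_not_kept :
  #|[set p : V * V | B p.1 p.2 && ~~ kept p.1 p.2]|%:R <= 5 * e ^+ 2 * N ^+ 2.
Proof.
pose low (v : V) := #|[set a | B v a]|%:R < e ^+ 2 * N.
pose S1 := [set p : V * V | B p.1 p.2 && low p.1].
pose S2 := [set p : V * V | B p.1 p.2 && low p.2].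
pose S3 := [set p : V * V | B p.1 p.2 && (K' * N ^+ 2 < #|deficient_pairs p.1 p.2|%:R)].
have : (#|[set p : V * V | B p.1 p.2 && ~~ kept p.1 p.2]| <= #|S1| + #|S2| + #|S3|)%N.
  apply: (@leq_trans #|S1 :|: S2 :|: S3|); last first.
    by apply: leq_trans (leq_card_setU _ _) _; rewrite leq_add2r leq_card_setU.
  apply/subset_leq_card/subsetP => p; rewrite !inE => /andP[hB].
  by rewrite /kept hB /= !negb_and -!ltNge orbA.
rewrite -(ler_nat R) !natrD => hS.
have low_sum (S : V -> {set V}) : (forall v, S v = if low v then [set a | B v a] else set0) ->
    \sum_v #|S v|%:R <= e ^+ 2 * N ^+ 2.
  move=> hSv; have -> : e ^+ 2 * N ^+ 2 = \sum_(v : V) (e ^+ 2 * N).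
    by rewrite sumr_const -[RHS]mulr_natr; ring.
  apply: ler_sum => v _; rewrite hSv; case: ifP; first by move=> /ltW.
  by rewrite cards0 mulr_ge0 ?exprn_even_ge0 // ltW.
have h1 : #|S1|%:R <= e ^+ 2 * N ^+ 2.
  rewrite (card_pairs (fun y x => B y x && low y)) natr_sum; apply: low_sum => v.
  by apply/setP => a; rewrite inE; case: (low v); rewrite ?inE ?andbT ?andbF.
have h2 : #|S2|%:R <= e ^+ 2 * N ^+ 2.
  rewrite (card_pairs (fun y x => B y x && low x)) card_pairsC natr_sum; apply: low_sum => v.
  by apply/setP => a; rewrite inE B_sym; case: (low v); rewrite ?inE ?andbT ?andbF.
have h3 : #|S3|%:R <= 3 * e ^+ 2 * N ^+ 2.
  have KN : 0 < K' * N ^+ 2 by rewrite mulr_gt0 ?exprn_gt0.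
  rewrite -(ler_pM2r KN).
  have -> : 3 * e ^+ 2 * N ^+ 2 * (K' * N ^+ 2) = 3 * K * N ^+ 4 by rewrite KE; ring.
  apply: le_trans card_deficient_total.
  rewrite mulr_natl -sumr_const big_mkcond /=; apply: ler_sum => p _.
  rewrite inE; case: ifP => // /andP[hB /ltW h]; apply: le_trans h _.
  by rewrite ler_nat; apply/subset_leq_card/subsetP => p'; rewrite !inE hB.
lra.
Qed.

End Cleaning.

(** * Counting the extensions of a closed walk *)

Lemma card_family_prod (aT rT : finType) (F : aT -> {set rT}) :
  #|family F| = (\prod_i #|F i|)%N.
Proof. by rewrite card_family foldrE big_image. Qed.

(** Two distinct coordinates of a random member of the family are independent and uniform: once they
    are fixed, [C] choices remain for the others. *)
Lemma card_family_pair (aT rT : finType) (F : aT -> {set rT}) (i j : aT)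
    (D : {set rT * rT}) : i != j ->
  (#|[set s in family F | (s i, s j) \in D]| * (#|F i| * #|F j|)
     <= #|D| * #|family F|)%N.
Proof.
move=> ij.
pose G (p : rT * rT) l := if l == i then [set p.1] else if l == j then [set p.2] else F l.
pose C := (\prod_(l | (l != i) && (l != j)) #|F l|)%N.
have cardG p : #|family (G p)| = C.
  rewrite card_family_prod (bigD1 i) //= (bigD1 j) 1?eq_sym //=.
  rewrite {1 2}/G eqxx eq_sym (negPf ij) eqxx !cards1 !mul1n.
  by apply: eq_bigr => l /andP[/negPf h1 /negPf h2]; rewrite /G h1 h2.
have -> : #|family F| = (#|F i| * #|F j| * C)%N.
  by rewrite card_family_prod (bigD1 i) //= (bigD1 j) 1?eq_sym //= mulnA.
rewrite mulnC [X in (_ <= X)%N]mulnCA leq_mul2l; apply/orP; right.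
apply: (@leq_trans #|\bigcup_(p in D) [set s in family (G p)]|).
  apply/subset_leq_card/subsetP => s; rewrite inE => /andP[/familyP hs hD].
  apply/bigcupP; exists (s i, s j) => //; rewrite inE; apply/familyP => l.
  rewrite /G; case: eqP => [->|_]; first by rewrite inE.
  by case: eqP => [->|_]; first by rewrite inE.
apply: leq_trans (leq_card_bigcup _ _) _.
rewrite -sum_nat_const; apply: leq_sum => p _.
by rewrite cardsE cardG.
Qed.

Section Extensions.
Variables (R : realType) (V : finType) (B : rel V).
Variables (H : {set V * V * V * V * V * V}) (e K K' : R).
Local Notation N := (#|V|%:R : R).
Variables (M : nat) (v : nat -> V).
Local Notation m := M.+1.
Hypothesis M_gt0 : (0 < M)%N.
Hypothesis v_closed : v m = v 0%N.
Hypothesis v_kept : forall i, (i < m)%N -> kept B H e K K' (v i) (v i.+1).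
Hypothesis e_gt0 : 0 < e.
Hypothesis K_ge0 : 0 <= K.
Hypothesis N_gt0 : 0 < N.
Hypothesis K'_le : 2 * m%:R * K' <= e ^+ 4.

Definition cyc_succ (i : 'I_m) : 'I_m := inZp i.+1.

Lemma cyc_succ_walk (i : 'I_m) : v (cyc_succ i) = v i.+1.
Proof.
rewrite /= ; have := ltn_ord i; rewrite leq_eqVlt => /orP[/eqP->|h].
  by rewrite modnn v_closed.
by rewrite modn_small.
Qed.

Lemma cyc_succ_neq (i : 'I_m) : i != cyc_succ i.
Proof.
apply/eqP => /(congr1 val) /=; have := ltn_ord i; rewrite leq_eqVlt => /orP[/eqP[hi]|h].
  by rewrite hi modnn => h0; move: M_gt0; rewrite h0.
by rewrite modn_small // => /esym/eqP; rewrite eqn_leq ltnn.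
Qed.

Definition spokes (i : 'I_m) : {set V} := [set a | B (v i) a].

Definition good_spokes : {set {ffun 'I_m -> V}} :=
  [set s in family spokes |
    [forall i : 'I_m, ~~ deficient B H K (v i) (v i.+1) (s i) (s (cyc_succ i))]].

Definition extensions : {set config V M} :=
  [set t | (t.1 \in good_spokes) && (t.2 \in family
     (fun i : 'I_m => good_paths B H (v i) (v i.+1) (t.1 i) (t.1 (cyc_succ i))))].

Lemma card_spokes i : e ^+ 2 * N <= #|spokes i|%:R.
Proof. by have /and4P[_ h _ _] := v_kept (ltn_ord i). Qed.

Lemma card_family_spokes : (e ^+ 2 * N) ^+ m <= #|family spokes|%:R.
Proof.
rewrite card_family_prod natr_prod -[X in _ ^+ X]card_ord -prodr_const.
apply: ler_prod => i _; rewrite card_spokes andbT.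
by rewrite mulr_ge0 ?exprn_ge0 ?ltW.
Qed.

(** Union bound: since [s i] and [s (cyc_succ i)] range independently over at least [e ^+ 2 * N]
    vertices each, a proportion at most [K' / e ^+ 4] of the families is bad at [i]. [K'_le] makes
    the total at most one half. *)
Lemma card_good_spokes : #|family spokes|%:R <= 2 * #|good_spokes|%:R :> R.
Proof.
pose bad i := [set s in family spokes |
   (s i, s (cyc_succ i)) \in deficient_pairs B H K (v i) (v i.+1)].
have h1 : (#|family spokes| <= #|good_spokes| + \sum_i #|bad i|)%N.
  apply: (@leq_trans (#|good_spokes| + #|\bigcup_(i in [set: 'I_m]) bad i|)%N); last first.
    rewrite leq_add2l; apply: leq_trans (leq_card_bigcup _ _) _.
    by apply/eq_leq/eq_bigl => i; rewrite inE.
  apply: leq_trans (leq_card_setU _ _); rewrite -cardsE.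
  apply/subset_leq_card/subsetP => s; rewrite in_set => hs.
  rewrite in_setU /good_spokes in_set hs /=.
  case: (boolP [forall _, _]) => //= /forallPn[i hi].
  apply/bigcupP; exists i; first by rewrite inE.
  rewrite /bad in_set hs /= in_set.
  rewrite negbK in hi; rewrite hi andbT.
  have /familyP hs' := hs; have := hs' i; have := hs' (cyc_succ i).
  by rewrite !inE cyc_succ_walk => -> ->.
have hbad i : #|bad i|%:R * e ^+ 4 <= K' * #|family spokes|%:R.
  have N2 : 0 < N ^+ 2 by apply: exprn_gt0.
  rewrite -(ler_pM2r N2).
  have := card_family_pair spokes
    (deficient_pairs B H K (v i) (v i.+1)) (cyc_succ_neq i).
  rewrite -/(bad i) -(ler_nat R) !natrM => hc.
  have /and4P[_ _ _ hd] := v_kept (ltn_ord i).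
  apply: (@le_trans _ _ (#|bad i|%:R * (#|spokes i|%:R * #|spokes (cyc_succ i)|%:R))).
    rewrite -mulrA; apply: ler_wpM2l => //.
    have -> : e ^+ 4 * N ^+ 2 = (e ^+ 2 * N) * (e ^+ 2 * N) by ring.
    by apply: ler_pM; rewrite ?card_spokes // mulr_ge0 ?exprn_ge0 ?ltW.
  apply: le_trans hc _; rewrite mulrAC; exact: ler_wpM2r.
have h2 : (\sum_i #|bad i|)%:R * e ^+ 4 <= m%:R * K' * #|family spokes|%:R.
  rewrite natr_sum mulr_suml.
  have -> : m%:R * K' * #|family spokes|%:R = \sum_(i < m) (K' * #|family spokes|%:R).
    by rewrite sumr_const card_ord -[RHS]mulr_natl mulrA.
  by apply: ler_sum => i _.
have e4 : 0 < e ^+ 4 by apply: exprn_gt0.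
have h3 : 2 * (\sum_i #|bad i|)%:R <= #|family spokes|%:R :> R.
  rewrite -(ler_pM2r e4) -mulrA.
  apply: (@le_trans _ _ (2 * (m%:R * K' * #|family spokes|%:R))).
    by rewrite ler_pM2l.
  by rewrite [leRHS]mulrC mulrA [2 * _]mulrA; apply: ler_wpM2r.
move: h1; rewrite -(ler_nat R) natrD; lra.
Qed.

(** Over good spokes the paths for different edges are chosen independently, with at least
    [K * N ^+ 2] choices each; the factor 2 pays for the bad spokes. *)
Lemma card_extensions :
  (e ^+ 2 * N) ^+ m * (K * N ^+ 2) ^+ m <= 2 * #|extensions|%:R.
Proof.
have KN : 0 <= K * N ^+ 2 by rewrite mulr_ge0 ?exprn_ge0.
rewrite (card_pairs (fun s c => (s \in good_spokes) && (c \in family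
     (fun i : 'I_m => good_paths B H (v i) (v i.+1) (s i) (s (cyc_succ i)))))).
apply: (@le_trans _ _ (2 * (#|good_spokes|%:R * (K * N ^+ 2) ^+ m))).
  rewrite mulrA; apply: ler_wpM2r; first exact: exprn_ge0.
  exact: le_trans card_family_spokes card_good_spokes.
rewrite ler_pM2l // natr_sum mulr_natl -sumr_const big_mkcond /=.
apply: ler_sum => s _; case: ifP => hs //.
rewrite /= cardsE card_family_prod natr_prod -[X in _ ^+ X]card_ord -prodr_const.
apply: ler_prod => i _; rewrite KN /=.
by move: hs; rewrite inE => /andP[_ /forallP/(_ i)]; rewrite /deficient -leNgt.
Qed.

End Extensions.

(** Pure arithmetic for the final count: [w] is the number of completions, [lam] the number of label
    sequences of rich inner walks, [D] and [D1] the choices per rectangle and per hexagon.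
    Eliminating [lam] leaves [n ^+ L.+1], which [N ^+ L.+1] absorbs. *)
Lemma bound_of_label_counts (R : realType) (x n N w lam D D1 : R) (a b m L : nat) :
  0 < x -> 0 < n -> n <= N -> 0 <= w -> 0 <= lam -> 0 <= D -> 0 <= D1 ->
  D * x ^+ 2 <= 1 -> D1 * x ^+ b <= 1 ->
  lam * (x ^+ (a + 3) * n ^+ 2) <= n ^+ L * (n ^+ 2 * D ^+ L.+1) ->
  w * (x ^+ a.+1 * N ^+ L.+1) <= n * lam * D1 ^+ m ->
  w * x ^+ (2 * a + 4 + 2 * L.+1 + b * m) <= 1.
Proof.
move=> x0 n0 nN w0 lam0 D0 D10 hD hD1 hlam hw.
have xk j : 0 <= x ^+ j by rewrite exprn_ge0 ?ltW.
have h1 : lam * x ^+ (a + 3) * (x ^+ 2) ^+ L.+1 <= n ^+ L.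
  have n2 : 0 < n ^+ 2 by apply: exprn_gt0.
  have h : lam * x ^+ (a + 3) <= n ^+ L * D ^+ L.+1.
    by rewrite -(ler_pM2r n2) -mulrA -[leRHS]mulrA [D ^+ _ * _]mulrC.
  apply: (@le_trans _ _ (n ^+ L * D ^+ L.+1 * (x ^+ 2) ^+ L.+1)).
    by apply: ler_wpM2r => //; rewrite exprn_ge0.
  rewrite -mulrA -exprMn -[leRHS]mulr1; apply: ler_wpM2l; first by rewrite exprn_ge0 ?ltW.
  by rewrite exprn_ile1 // mulr_ge0.
have N0 : 0 < N by apply: lt_le_trans nN.
have NL : 0 < N ^+ L.+1 by apply: exprn_gt0.
rewrite -(ler_pM2r NL) mul1r.
have -> : w * x ^+ (2 * a + 4 + 2 * L.+1 + b * m) * N ^+ L.+1 =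
  w * (x ^+ a.+1 * N ^+ L.+1) * (x ^+ (a + 3) * (x ^+ 2) ^+ L.+1 * (x ^+ b) ^+ m).
  have -> : x ^+ (2 * a + 4 + 2 * L.+1 + b * m) =
      x ^+ a.+1 * (x ^+ (a + 3) * (x ^+ 2) ^+ L.+1 * (x ^+ b) ^+ m).
    by rewrite -!exprM -!exprD; congr (_ ^+ _); clear; lia.
  move: (x ^+ (a + 3)) ((x ^+ 2) ^+ L.+1) ((x ^+ b) ^+ m) (x ^+ a.+1) (N ^+ L.+1) => *; ring.
apply: (@le_trans _ _ (n * lam * D1 ^+ m * (x ^+ (a + 3) * (x ^+ 2) ^+ L.+1 * (x ^+ b) ^+ m))).
  by apply: ler_wpM2r => //; rewrite !mulr_ge0 // exprn_ge0.
have -> : n * lam * D1 ^+ m * (x ^+ (a + 3) * (x ^+ 2) ^+ L.+1 * (x ^+ b) ^+ m) =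
  n * (lam * x ^+ (a + 3) * (x ^+ 2) ^+ L.+1) * (D1 * x ^+ b) ^+ m.
  rewrite [(D1 * _) ^+ m]exprMn.
  by move: (x ^+ (a + 3)) ((x ^+ 2) ^+ L.+1) ((x ^+ b) ^+ m) (D1 ^+ m) => *; ring.
apply: (@le_trans _ _ (n * n ^+ L * 1)).
  have h2 : (D1 * x ^+ b) ^+ m <= 1 by rewrite exprn_ile1 // mulr_ge0.
  have h3 : 0 <= (D1 * x ^+ b) ^+ m by rewrite exprn_ge0 // mulr_ge0.
  move: h1; set u := lam * _ * _ => h1.
  have u0 : 0 <= u by rewrite /u !mulr_ge0 // exprn_ge0.
  by apply: ler_pM => //; [apply: mulr_ge0 => //; exact: ltW | apply: ler_wpM2l => //; exact: ltW].
by rewrite mulr1 -exprS lerXn2r // ?nnegrE ltW.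
Qed.

(** * Rich walks and their labels in a graph with pivots *)

(* [gm q] stands for the label of the pivot [q], [sg q v] for the label of the
   spoke from [v] to the opposite end of [q], and [Rl (gm q) z s t] for the
   popularity of the rectangle on [q] and an edge labelled [z] whose ends have
   spokes labelled [s] and [t]. *)
Section PivotedGraph.
Variables (R : realType) (V Z Q : finType) (lab : V -> V -> Z) (E : rel V).
Variables (Bq : Q -> rel V) (sg : Q -> V -> Z) (gm : Q -> Z).
Variables (Rl : Z -> Z -> Z -> Z -> bool) (D : nat).
Hypothesis lab_sym : forall v w, lab v w = lab w v.
Hypothesis lab_inj : forall v w w', E v w -> E v w' -> lab v w = lab v w' -> w = w'.
Hypothesis BqE : forall q v w, Bq q v w -> E v w.
Hypothesis Bq_sym : forall q v w, Bq q v w = Bq q w v.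
Hypothesis BqR : forall q v w, Bq q v w -> Rl (gm q) (lab v w) (sg q v) (sg q w).
Hypothesis Rl_end : forall c z s, (#|[set t | Rl c z s t]| <= D)%N.
Hypothesis Rl_lab : forall c s t, (#|[set z | Rl c z s t]| <= D)%N.
Hypothesis pivot_inj : forall q q' v w w', Bq q v w -> Bq q' v w' ->
  gm q = gm q' -> sg q v = sg q' v -> q = q'.

Definition pivots (w : nat -> V) (L : nat) : {set Q} :=
  [set q | all (fun i => Bq q (w i) (w i.+1)) (iota 0 L)].

Lemma pivotsP (w : nat -> V) (L : nat) q :
  reflect (forall i, (i < L)%N -> Bq q (w i) (w i.+1)) (q \in pivots w L).
Proof.
rewrite inE; apply: (iffP allP) => h i.
  by move=> hi; apply: h; rewrite mem_iota.
by rewrite mem_iota => /andP[_]; apply: h.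
Qed.

(** Count pairs of a last label [z] and a pivot [q] of a walk chosen for [z]. The pair is determined
    by [z], the label of [q] and that of the first spoke ([pivot_inj]). The last two labels take
    [#|Z| ^ 2] values, after which [z] is reached in [L.+1] steps with [D] choices each. *)
Lemma completions_of_rich_walks (L : nat) (l : nat -> Z) (W : {set Z}) (P : R) :
  (forall z, z \in W -> exists w : nat -> V,
     [/\ w L.+1 = w 0%N, forall i, (i < L)%N -> lab (w i) (w i.+1) = l i,
         lab (w L) (w L.+1) = z & P <= #|pivots w L.+1|%:R]) ->
  #|W|%:R * P <= (#|Z| ^ 2 * D ^ L.+1)%:R.
Proof.
case: (set_0Vmem W) => [->|[z0 z0W]] hW; first by rewrite cards0 mul0r ler0n.
have [w0 _] := hW _ z0W.
have /fin_all_exists [ws hws] : forall z, exists w : nat -> V, z \in W ->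
   [/\ w L.+1 = w 0%N, forall i, (i < L)%N -> lab (w i) (w i.+1) = l i,
         lab (w L) (w L.+1) = z & P <= #|pivots w L.+1|%:R].
  move=> z; case zW: (z \in W); last by exists w0.
  by have [w hw] := hW _ zW; exists w.
pose S := [set p : Z * Q | (p.1 \in W) && (p.2 \in pivots (ws p.1) L.+1)].
have cardS : #|W|%:R * P <= #|S|%:R.
  apply: (@card_dep_pairs_ge _ _ _ W (fun z => pivots (ws z) L.+1)) => z zW.
  by have [_ _ _] := hws z zW.
apply: le_trans cardS _; rewrite ler_nat.
(* [f] holds the labels of the pivot and of the first spoke. The state is the current spoke label;
   the last rectangle returns to the first spoke, so there the unknown is the label of the closing
   edge. *)
pose step (f : Z * Z) e s t :=
  if (e < L)%N then Rl f.1 (l e) s t else Rl f.1 t s f.2.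
pose code (p : Z * Q) := ((gm p.2, sg p.2 (ws p.1 0%N)), p.1).
have code_inj : {in S &, injective code}.
  move=> [z q] [z' q']; rewrite inE => /andP[_ /pivotsP hq].
  rewrite inE => /andP[_ /pivotsP hq'].
  case=> e1 e2 e3; subst z'; congr (_, _).
  exact: (pivot_inj (hq 0%N isT) (hq' 0%N isT) e1 e2).
rewrite -(card_in_imset code_inj).
apply: (@leq_trans #|[set x : (Z * Z) * Z | x.2 \in reach (step x.1) x.1.2 L.+1]|).
  apply/subset_leq_card/subsetP => _ /imsetP[[z q] zqS ->].
  rewrite inE in zqS; case/andP: zqS => zW /pivotsP hq.
  rewrite inE /code; cbn [fst snd] in *.
  have [hcl hl hz _] := hws z zW.
  pose st e := if (e <= L)%N then sg q (ws z e) else z.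
  have stL : st L.+1 = z by rewrite /st ltnn.
  rewrite -[X in X \in _]stL; apply: (@mem_reach _ _ st) => e.
  rewrite ltnS leq_eqVlt => /orP[/eqP->|he].
    by rewrite stL /step /st ltnn leqnn /= -{1}hz -hcl; apply/BqR/hq.
  rewrite /step /st he (ltnW he) -hl //; apply: BqR; apply: hq; exact: ltnW.
rewrite (card_pairs (fun x t => t \in reach (step x) x.2 L.+1)).
have -> : (#|Z| ^ 2 * D ^ L.+1 = \sum_(x : Z * Z) D ^ L.+1)%N.
  by rewrite sum_nat_const card_prod expnS expn1.
apply: leq_sum => x _.
rewrite (_ : [set _ | _] = reach (step x) x.2 L.+1); last by apply/setP=> t; rewrite inE.
apply: card_reach => e s; rewrite /step; case: (e < L)%N; [exact: Rl_end|exact: Rl_lab].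
Qed.


Definition hexagon (h : V * V * V * V * V * V) : nat -> V :=
  let: (y, a, c, d, b, x) := h in nth y [:: y; a; c; d; b; x; y].

Section Thresholds.
Variables (hex_min walk_min : R) (hex_bound : nat).

Definition rich_hexagon (h : V * V * V * V * V * V) : bool :=
  hex_min <= #|pivots (hexagon h) 6|%:R.

(** [r] and [t] label the spokes [y a] and [b x], [p q s] the path between their ends, and [z] the
    edge [x y] of the outer walk. *)
Definition rich_labels (r p q s t z : Z) : bool :=
  [exists h : V * V * V * V * V * V, let w := hexagon h in
    [&& lab (w 0%N) (w 1%N) == r, lab (w 1%N) (w 2%N) == p,
        lab (w 2%N) (w 3%N) == q, lab (w 3%N) (w 4%N) == s,
        lab (w 4%N) (w 5%N) == t, lab (w 5%N) (w 6%N) == z & rich_hexagon h]].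

Lemma card_rich_labels_last r p q s t :
  #|[set z | rich_labels r p q s t z]|%:R * hex_min <= (#|Z| ^ 2 * D ^ 6)%:R.
Proof.
apply: (@completions_of_rich_walks 5 (nth r [:: r; p; q; s; t])) => z.
rewrite inE => /existsP[[[[[[y a] c] d] b] x]].
case/and5P=> /eqP h0 /eqP h1 /eqP h2 /eqP h3 /and3P[/eqP h4 /eqP h5 hr].
exists (hexagon (y, a, c, d, b, x)); split=> //.
by case=> [|[|[|[|[|i]]]]].
Qed.

Lemma card_rich_labels_spoke r p q s z :
  #|[set t | rich_labels r p q s t z]|%:R * hex_min <= (#|Z| ^ 2 * D ^ 6)%:R.
Proof.
apply: (@completions_of_rich_walks 5 (nth r [:: z; r; p; q; s])) => t.
rewrite inE => /existsP[[[[[[y a] c] d] b] x]].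
case/and5P=> /eqP h0 /eqP h1 /eqP h2 /eqP h3 /and3P[/eqP h4 /eqP h5 hr].
(* Rotated to start at [x], the hexagon has the spoke [b x] as its last edge and keeps its
   pivots. *)
exists (hexagon (x, y, a, c, d, b)); split=> //.
  by case=> [|[|[|[|[|i]]]]].
apply: le_trans hr _; rewrite ler_nat; apply/subset_leq_card/subsetP => q'.
rewrite !inE /=; by case/and5P=> -> -> -> -> /and3P[-> -> _].
Qed.

(** * Label sequences of inner walks and the count of completions *)

Section InnerWalks.
Variable M : nat.
Local Notation m := M.+1.
Local Notation L := (3 * M).+2.
Local Notation config := (config V M).

Definition rich_config (t : config) : bool := walk_min <= #|pivots (inner t) L.+1|%:R.

(** The last label is kept apart: the first [L] are free, and richness bounds the last one in terms
    of them. *)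
Definition inner_labels (t : config) : {ffun 'I_L -> Z} * Z :=
  ([ffun i : 'I_L => lab (inner t i) (inner t i.+1)],
   lab (inner t L) (inner t L.+1)).

Definition nth_label (g : {ffun 'I_L -> Z} * Z) (j : nat) : Z :=
  if insub j is Some i then g.1 i else g.2.

Lemma nth_inner_labels t j : (j < L.+1)%N ->
  nth_label (inner_labels t) j = lab (inner t j) (inner t j.+1).
Proof.
rewrite ltnS leq_eqVlt => /orP[/eqP->|hj].
  by rewrite /nth_label insubN ?ltnn.
by rewrite /nth_label insubT /= ffunE.
Qed.

Definition rich_inner_labels : {set {ffun 'I_L -> Z} * Z} :=
  [set g | [exists t, (inner_labels t == g) && rich_config t]].

Lemma card_rich_inner_labels :
  #|rich_inner_labels|%:R * walk_min <= (#|Z| ^ L * (#|Z| ^ 2 * D ^ L.+1))%:R.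
Proof.
pose P (h : {ffun 'I_L -> Z}) z := [exists t, (inner_labels t == (h, z)) && rich_config t].
rewrite (_ : rich_inner_labels = [set g | P g.1 g.2]); last first.
  by apply/setP=> -[h z]; rewrite !inE.
rewrite card_pairs natr_sum mulr_suml natrM.
have -> : (#|Z| ^ L)%:R = \sum_(h : {ffun 'I_L -> Z}) (1 : R).
  by rewrite sumr_const card_ffun card_ord.
rewrite mulr_suml; apply: ler_sum => h _; rewrite mul1r.
pose l (j : nat) := if insub j is Some i then h i else h ord0.
apply: (@completions_of_rich_walks L l) => z.
rewrite inE => /existsP[t /andP[/eqP ht hr]].
exists (inner t); split=> //; first exact: inner_closed.
- by move=> i hi; rewrite /l insubT /=; case: ht => <- _; rewrite ffunE.
- by case: ht.
Qed.


Lemma walk_eq_of_labels (w w' : nat -> V) n :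
  (forall j, (j < n)%N -> E (w j) (w j.+1)) ->
  (forall j, (j < n)%N -> E (w' j) (w' j.+1)) ->
  (forall j, (j < n)%N -> lab (w j) (w j.+1) = lab (w' j) (w' j.+1)) ->
  w 0%N = w' 0%N -> forall j, (j <= n)%N -> w j = w' j.
Proof.
move=> hw hw' hl h0; elim=> [//|j IH] hj.
have ej := IH (ltnW hj).
apply: (lab_inj (hw _ hj)); last by rewrite hl // -ej.
by rewrite ej; apply: hw'.
Qed.

(** Count pairs of a completion [z] and an extension [t] of the walk chosen for [z]. The first spoke
    label and the inner labels recover [t] from [vs z], by [lab_inj]. Conversely these labels, with
    [l], leave at most [hex_bound ^ m] values of [z]: cross the hexagons one after another. *)
Lemma count_completions (l : nat -> Z) (W : {set Z}) (vs : Z -> nat -> V)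
    (Ext : Z -> {set config}) (K : R) :
  (forall r p q s t, (#|[set z | rich_labels r p q s t z]| <= hex_bound)%N) ->
  (forall r p q s z, (#|[set t | rich_labels r p q s t z]| <= hex_bound)%N) ->
  (forall z, z \in W ->
     [/\ vs z m = vs z 0%N,
         forall e, (e < M)%N -> lab (vs z e) (vs z e.+1) = l e,
         lab (vs z M) (vs z m) = z & K <= #|Ext z|%:R]) ->
  (forall z t, z \in W -> t \in Ext z ->
     [/\ E (vs z 0%N) (inner t 0%N),
         forall j, (j < L.+1)%N -> E (inner t j) (inner t j.+1),
         forall e, (e < m)%N -> rich_hexagon (vs z e, inner t (3 * e),
           inner t (3 * e).+1, inner t (3 * e).+2, inner t (3 * e).+3, vs z e.+1)
       & rich_config t]) ->
  #|W|%:R * K <= (#|Z| * #|rich_inner_labels| * hex_bound ^ m)%:R.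
Proof.
move=> hD1 hD2 hW hExt.
pose S := [set p : Z * config | (p.1 \in W) && (p.2 \in Ext p.1)].
have cardS : #|W|%:R * K <= #|S|%:R.
  apply: (@card_dep_pairs_ge _ _ _ W Ext) => z zW.
  by have [_ _ _] := hW z zW.
apply: le_trans cardS _; rewrite ler_nat.
(* The first [M] hexagons have a known outer label and an unknown next spoke; the last one returns
   to the first spoke, labelled [f.1], and its outer label is the unknown. *)
pose step (f : Z * ({ffun 'I_L -> Z} * Z)) e s t :=
  let g := nth_label f.2 in
  if (e < M)%N then rich_labels s (g (3 * e)%N) (g (3 * e).+1) (g (3 * e).+2) t (l e)
  else rich_labels s (g (3 * e)%N) (g (3 * e).+1) (g (3 * e).+2) f.1 t.
pose code (p : Z * config) :=
  ((lab (vs p.1 0%N) (inner p.2 0%N), inner_labels p.2), p.1).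
have code_inj : {in S &, injective code}.
  move=> [z t] [z' t'] hz hz'.
  rewrite inE in hz; case/andP: hz; cbn [fst snd] => zW ht.
  rewrite inE in hz'; case/andP: hz'; cbn [fst snd] => zW' ht'.
  rewrite /code; cbn [fst snd] => -[] e1 e2 e3 e4; subst z'; congr (_, _).
  have [a1 a2 _ _] := hExt _ _ zW ht; have [b1 b2 _ _] := hExt _ _ zW ht'.
  apply: config_eq => j hj.
  apply: (@walk_eq_of_labels _ _ L.+1) => //; last 1 first.
  - exact: ltnW.
  - move=> i hi; rewrite -!nth_inner_labels // /inner_labels.
    by congr (nth_label (_, _) _).
  exact: lab_inj a1 b1 e1.
rewrite -(card_in_imset code_inj).
apply: (@leq_trans #|[set x : (Z * ({ffun 'I_L -> Z} * Z)) * Z |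
   (x.1.2 \in rich_inner_labels) && (x.2 \in reach (step x.1) x.1.1 m)]|).
  apply/subset_leq_card/subsetP => _ /imsetP[[z t] ztS ->].
  rewrite inE in ztS; case/andP: ztS; cbn [fst snd] => zW ht.
  rewrite inE /code; cbn [fst snd].
  have [hcl hl hz _] := hW z zW; have [_ _ hhex hrc] := hExt _ _ zW ht.
  apply/andP; split; first by rewrite inE; apply/existsP; exists t; rewrite eqxx.
  pose st e := if (e <= M)%N then lab (vs z e) (inner t (3 * e)) else z.
  have stm : st m = z by rewrite /st ltnn.
  have st0 : lab (vs z 0%N) (inner t 0%N) = st 0%N by rewrite /st muln0.
  rewrite -[X in X \in _]stm [in reach _ _]st0; apply: (@mem_reach _ _ st) => e he.
  have hx := hhex e he; rewrite /step; cbn [fst snd].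
  have -> : st e = lab (vs z e) (inner t (3 * e)) by rewrite /st -ltnS he.
  have h3 : (3 * e < L.+1)%N by lia.
  have h4 : ((3 * e).+1 < L.+1)%N by lia.
  have h5 : ((3 * e).+2 < L.+1)%N by lia.
  rewrite !nth_inner_labels //.
  have stS : (e < M)%N -> lab (inner t (3 * e).+3) (vs z e.+1) = st e.+1.
    by move=> heM; rewrite /st heM lab_sym -addn3 -mulnSr.
  case: ifP => heM; apply/existsP; exists (vs z e, inner t (3 * e),
    inner t (3 * e).+1, inner t (3 * e).+2, inner t (3 * e).+3, vs z e.+1).
    rewrite /= !eqxx stS // eqxx lab_sym hl // eqxx; exact: hx.
  have eM : e = M by move: he heM; rewrite ltnS => ? ?; lia.
  rewrite /= !eqxx; move: hx; rewrite eM => hx.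
  have -> : lab (inner t L.+1) (vs z m) = lab (vs z 0%N) (inner t 0%N).
    by rewrite lab_sym hcl inner_closed.
  have -> : lab (vs z m) (vs z M) = st m by rewrite stm lab_sym.
  by rewrite !eqxx hx.
rewrite (card_pairs (fun x t => (x.2 \in rich_inner_labels) && (t \in reach (step x) x.1 m))).
apply: (@leq_trans (\sum_(x : Z * ({ffun 'I_L -> Z} * Z)
    | x.2 \in rich_inner_labels) hex_bound ^ m)%N).
  rewrite [X in (_ <= X)%N]big_mkcond /=; apply: leq_sum => x _.
  case: ifP => hx; last by rewrite (_ : [set _ | _] = set0) ?cards0 //;
    apply/setP=> t; rewrite !inE.
  rewrite (_ : [set _ | _] = reach (step x) x.1 m); last by apply/setP=> t; rewrite inE.
  by apply: card_reach => e s; rewrite /step /=; case: (e < M)%N; [exact: hD2|exact: hD1].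
rewrite sum_nat_const leq_mul2r; apply/orP; right.
rewrite -cardsT -cardsX; apply/eq_leq/eq_card => -[x1 x2].
by rewrite in_setX in_setT unfold_in.
Qed.

End InnerWalks.
End Thresholds.

(** * Choice of the parameters and of the pivot *)

Section Density.
Variables (e : R) (k M : nat).
Local Notation N := (#|V|%:R : R).
Local Notation m := M.+1.
Local Notation L := (3 * M).+2.
Hypothesis e_gt0 : 0 < e.
Hypothesis e_lt : e < 10 ^- 3.
Hypothesis k_ge2 : (2 <= k)%N.
Hypothesis M_def : M.+1 = (2 * k)%N.
Hypothesis Z_gt0 : (0 < #|Z|)%N.
Hypothesis card_V : #|V| = (2 * #|Z|)%N.
Hypothesis card_Q : #|Q| = (#|Z| ^ 2)%N.
Hypothesis D_le : D%:R * e ^+ 2 <= 1.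
Hypothesis Bq_dense :
  e / 4 * #|Q|%:R * N ^+ 2 <= \sum_q #|[set p : V * V | Bq q p.1 p.2]|%:R.

(* The numbers of spokes and of paths for each of the [m = 2 * k] edges give
   [(e ^+ 2 * K) ^+ m = e ^+ a]. *)
Let a := (2 * k ^ 2 + 16 * k)%N.
(** [K'] is small enough for [4 * k * K' <= e ^+ 4], and [K = e ^+ 2 * K'] as the cleaning requires.
    The thresholds are [e ^+ 2 * #|Q|] times the tolerated proportions [K ^+ 2] of poor hexagons and
    [e ^+ a.+1] of poor configurations. *)
Let K' := e ^+ (k + 4).
Let K := e ^+ (k + 6).
Let hex_min := e ^+ (2 * k + 14) * #|Q|%:R.
Let walk_min := e ^+ (a + 3) * #|Q|%:R.

Definition poor_hexagons (q : Q) : {set V * V * V * V * V * V} :=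
  [set h | (q \in pivots (hexagon h) 6) && ~~ rich_hexagon hex_min h].

Definition poor_configs (q : Q) : {set config V M} :=
  [set t | (q \in pivots (inner t) L.+1) && ~~ rich_config walk_min t].

Lemma e_small : e < 1 / 1000.
Proof. by have <- : 10 ^- 3 = 1 / 1000 :> R by field. Qed.

Lemma card_V_gt0 : 0 < N.
Proof. by rewrite ltr0n card_V muln_gt0 Z_gt0. Qed.

(** Dependent random choice: an object with few pivots survives in [Bq q] for few [q], so [sum_poor]
    bounds the average numbers of poor hexagons and configurations by [e ^+ 2] times what is
    tolerated. *)
Lemma exists_rich_pivot : exists q,
  [/\ e / 8 * N ^+ 2 <= #|[set p : V * V | Bq q p.1 p.2]|%:R,
      #|poor_hexagons q|%:R <= K ^+ 2 * N ^+ 6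
    & #|poor_configs q|%:R <= e ^+ a.+1 * N ^+ L.+1].
Proof.
have N0 := card_V_gt0.
have N2 : 0 < N ^+ 2 by apply: exprn_gt0.
have c1 : 0 < K ^+ 2 * N ^+ 6 by rewrite mulr_gt0 ?exprn_gt0.
have c2 : 0 < e ^+ a.+1 * N ^+ L.+1 by rewrite mulr_gt0 ?exprn_gt0.
pose f q : R := #|[set p : V * V | Bq q p.1 p.2]|%:R / N ^+ 2.
pose g1 q : R := #|poor_hexagons q|%:R / (K ^+ 2 * N ^+ 6).
pose g2 q : R := #|poor_configs q|%:R / (e ^+ a.+1 * N ^+ L.+1).
have sum1 : \sum_q #|poor_hexagons q|%:R <= N ^+ 6 * hex_min.
  have := @sum_poor R Q _ (fun q h => q \in pivots (hexagon h) 6) hex_min.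
  have -> : #|{: V * V * V * V * V * V}|%:R = N ^+ 6 by rewrite !card_prod !natrM; ring.
  move=> h; apply: le_trans (h _); last first.
    by apply: mulr_ge0 => //; apply/exprn_ge0/ltW.
  apply: ler_sum => q _; rewrite ler_nat; apply/subset_leq_card/subsetP => h'.
  rewrite inE => /andP[h1 h2]; rewrite inE h1 /= ltNge.
  by move: h2; rewrite /rich_hexagon; congr (~~ (_ <= _%:R)); apply: eq_card => q'; rewrite inE.
have sum2 : \sum_q #|poor_configs q|%:R <= N ^+ L.+1 * walk_min.
  have := @sum_poor R Q _ (fun q t => q \in pivots (@inner V M t) L.+1) walk_min.
  have -> : #|{: config V M}|%:R = N ^+ L.+1.
    rewrite card_prod !card_ffun card_prod card_ord -natrX; congr (_%:R).
    by rewrite expnMn -!expnD; congr (_ ^ _)%N; clear; lia.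
  move=> h; apply: le_trans (h _); last first.
    by apply: mulr_ge0 => //; apply/exprn_ge0/ltW.
  apply: ler_sum => q _; rewrite ler_nat; apply/subset_leq_card/subsetP => h'.
  rewrite inE => /andP[h1 h2]; rewrite inE h1 /= ltNge.
  by move: h2; rewrite /rich_config; congr (~~ (_ <= _%:R)); apply: eq_card => q'; rewrite inE.
have [|||||||q [h1 h2 h3]] := @exists_good_pivot R Q e f g1 g2 _ e_gt0 e_lt.
- by rewrite card_Q expn_gt0 Z_gt0.
- move=> q; rewrite ler_pdivrMr // mul1r -natrX ler_nat.
  by apply: leq_trans (max_card _) _; rewrite card_prod expnS expn1.
- by move=> q; rewrite divr_ge0 ?ler0n // ltW.
- by move=> q; rewrite divr_ge0 ?ler0n // ltW.
- by rewrite /f -mulr_suml ler_pdivlMr.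
- rewrite /g1 -mulr_suml ler_pdivrMr //; apply: le_trans sum1 _.
  rewrite le_eqVlt; apply/orP; left; apply/eqP; rewrite /hex_min /K -exprM.
  have -> : e ^+ (2 * k + 14) = e ^+ 2 * e ^+ ((k + 6) * 2).
    by rewrite -exprD; congr (_ ^+ _); clear; lia.
  ring.
- rewrite /g2 -mulr_suml ler_pdivrMr //; apply: le_trans sum2 _.
  rewrite le_eqVlt; apply/orP; left; apply/eqP; rewrite /walk_min.
  have -> : e ^+ (a + 3) = e ^+ 2 * e ^+ a.+1.
    by rewrite -exprD; congr (_ ^+ _); clear; lia.
  move: (e ^+ a.+1) (N ^+ L.+1) => *; ring.
exists q; split.
- by move: h1; rewrite /f ler_pdivlMr.
- by move: h2; rewrite /g1 ler_pdivrMr // mul1r.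
- by move: h3; rewrite /g2 ler_pdivrMr // mul1r.
Qed.


Lemma nat_mul_expr_le1 j : 4 * j.+1%:R * e ^+ j.+1 <= 1.
Proof.
have e1 := e_small; elim: j => [|j IH]; first by rewrite expr1; lra.
apply: le_trans IH; rewrite [e ^+ j.+2]exprS.
have h0 : 0 < e ^+ j.+1 by apply: exprn_gt0.
rewrite !mulrA ler_pM2r // -[j.+2%:R]natr1.
have : 1 <= j.+1%:R :> R by rewrite ler1n.
move: (j.+1%:R : R) => J J1; have J2 : 0 <= J * (1 / 1000 - e) by rewrite mulr_ge0 //; lra.
have : J * (1 / 1000 - e) = J / 1000 - J * e by ring.
have -> : 4 * (J + 1) * e = 4 * (J * e) + 4 * e by ring.
lra.
Qed.

Lemma K'_le : 2 * m%:R * K' <= e ^+ 4.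
Proof.
rewrite M_def /K' exprD mulrA -[leRHS]mul1r.
apply: ler_wpM2r; first by apply/exprn_ge0/ltW.
case: k k_ge2 => [//|j] _; have := nat_mul_expr_le1 j.
by have -> : 2 * (2 * j.+1)%:R = 4 * j.+1%:R :> R by rewrite natrM mulrA -natrM.
Qed.

(** * Extensions in the graph of a fixed pivot *)

Section FixedPivot.
Variables (q : Q) (v : nat -> V) (t : config V M).
Local Notation B := (Bq q).
Local Notation H := (poor_hexagons q).
Hypothesis v_closed : v m = v 0%N.
Hypothesis v_edge : forall i, (i < m)%N -> B (v i) (v i.+1).
Hypothesis t_ext : t \in extensions B H K M v.

Lemma extension_spoke i : B (v (inZp i : 'I_m)) (t.1 (inZp i)).
Proof.
move: t_ext; rewrite inE => /andP[+ _].
by rewrite inE => /andP[/familyP/(_ (inZp i))]; rewrite inE.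
Qed.

Lemma extension_path i : (i < m)%N -> let c := (t.2 (inZp i)).1 in
    let d := (t.2 (inZp i)).2 in
  [/\ B (t.1 (inZp i)) c, B c d, B d (t.1 (inZp i.+1))
    & (v i, t.1 (inZp i), c, d, t.1 (inZp i.+1), v i.+1) \notin H].
Proof.
move=> hi; move: t_ext; rewrite inE => /andP[_ /familyP/(_ (inZp i))].
have -> : cyc_succ (inZp i : 'I_m) = inZp i.+1.
  by apply: val_inj; rewrite /= (modn_small hi).
rewrite /good_paths /paths3 !inE => /andP[/and3P[h1 h2 h3]].
by rewrite /= modn_small.
Qed.

Lemma extension_inner j : (j < L.+1)%N -> B (inner t j) (inner t j.+1).
Proof.
move=> hj; rewrite (divn_eq j 3) mulnC.
have hi : (j %/ 3 < m)%N by rewrite ltn_divLR //; move: hj; clear; lia.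
have [h1 h2 h3 _] := extension_path hi.
have := ltn_mod j 3; case: (j %% 3)%N => [|[|[|//]]] _.
- by rewrite addn0 inner1 inner0.
- by rewrite addn1 inner2 inner1.
- by rewrite addn2 inner3 inner2.
Qed.

(** All six edges lie in [Bq q], so a hexagon that is not rich would belong to [H], which good paths
    avoid. *)
Lemma extension_rich_hexagon i : (i < m)%N ->
  rich_hexagon hex_min (v i, inner t (3 * i), inner t (3 * i).+1, inner t (3 * i).+2,
                   inner t (3 * i).+3, v i.+1).
Proof.
move=> hi; rewrite inner0 inner1 inner2 inner3.
have [h1 h2 h3] := extension_path hi; apply: contraNT => hr.
rewrite inE hr andbT inE /= h1 h2 h3 /= [B (v i.+1) _]Bq_sym (v_edge hi) /= andbT.
have := extension_spoke i; rewrite /= modn_small // => -> /=.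
have := extension_spoke i.+1; rewrite Bq_sym /=.
move: hi; rewrite leq_eqVlt => /orP[/eqP hi|hi]; last by rewrite modn_small.
by rewrite [in X in Bq q _ (v X)]hi modnn hi v_closed.
Qed.

End FixedPivot.

Theorem exists_bounded_completions : exists B : rel V,
  [/\ forall v w, B v w = B w v, forall v w, B v w -> E v w,
      e / 16 * N ^+ 2 <= #|[set p : V * V | B p.1 p.2]|%:R
    & forall (l : nat -> Z) (W : {set Z}),
      (forall z, z \in W -> exists v : nat -> V,
        [/\ v m = v 0%N, forall i, (i < m)%N -> B (v i) (v i.+1),
            forall i, (i < M)%N -> lab (v i) (v i.+1) = l i
          & lab (v M) (v m) = z]) ->
      #|W|%:R <= e ^- (33 * k ^ 3)].
Proof.
have N0 := card_V_gt0; have e1 := e_small.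
have [q [hB hH hC]] := exists_rich_pivot.
have K0 : 0 < K by apply: exprn_gt0.
have K'0 : 0 < K' by apply: exprn_gt0.
have KE : K = e ^+ 2 * K' by rewrite /K /K' -exprD; congr (_ ^+ _); clear; lia.
pose H := poor_hexagons q.
pose ok := kept (Bq q) H e K K'.
(* [kept] refers to an orientation of the edge; requiring both orientations makes [B] symmetric and
   at most doubles the loss. *)
pose B v w := ok v w && ok w v.
have okB v w : ok v w -> Bq q v w by case/and4P.
have nk := card_not_kept (Bq_sym q) hH K0 N0 K'0 KE.
exists B; split.
- by move=> v w; rewrite /B andbC.
- by move=> v w /andP[/okB /BqE].
- have : (#|[set p : V * V | Bq q p.1 p.2]| <= #|[set p : V * V | B p.1 p.2]| +
     (#|[set p : V * V | Bq q p.1 p.2 && ~~ ok p.1 p.2]| +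
      #|[set p : V * V | Bq q p.1 p.2 && ~~ ok p.1 p.2]|))%N.
    pose sw (p : V * V) := (p.2, p.1).
    have swK : involutive sw by case.
    rewrite -[X in (_ <= _ + (_ + X))%N](card_imset _ (inv_inj swK)).
    apply: (@leq_trans #|[set p : V * V | B p.1 p.2] :|:
      ([set p : V * V | Bq q p.1 p.2 && ~~ ok p.1 p.2] :|:
      [set sw p | p in [set p : V * V | Bq q p.1 p.2 && ~~ ok p.1 p.2]])|); last first.
      by apply: leq_trans (leq_card_setU _ _) _; rewrite leq_add2l leq_card_setU.
    apply/subset_leq_card/subsetP => p; rewrite inE => hp.
    rewrite !in_setU [p \in [set _ | B _ _]]inE [p \in [set _ | _ && _]]inE hp /= /B.
    case: (boolP (ok p.1 p.2)) => //= h1; case: (boolP (ok p.2 p.1)) => //= h2.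
    by apply/imsetP; exists (sw p); [rewrite inE /= Bq_sym hp|rewrite swK].
  rewrite -(ler_nat R) !natrD => h; move: nk hB h; rewrite -/H -/ok.
  (* The loss [10 * e ^+ 2 * N ^+ 2] is at most [e / 100 * N ^+ 2], which leaves more than
     [e / 16 * N ^+ 2]. *)
  have : e ^+ 2 * N ^+ 2 <= e / 1000 * N ^+ 2.
    by apply: ler_wpM2r; [apply/exprn_ge0/ltW | rewrite expr2; move: e_gt0; nra].
  have : 0 < e * N ^+ 2 by rewrite mulr_gt0 ?exprn_gt0.
  by move: (#|[set p : V * V | B p.1 p.2]|%:R : R) => *; lra.
move=> l W hW.
case: (set_0Vmem W) => [->|[z0 z0W]].
  by rewrite cards0 invr_ge0 exprn_ge0 // ltW.
have [v0 _] := hW _ z0W.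
have /fin_all_exists [vs hvs] : forall z, exists v : nat -> V, z \in W ->
   [/\ v m = v 0%N, forall i, (i < m)%N -> B (v i) (v i.+1),
            forall i, (i < M)%N -> lab (v i) (v i.+1) = l i
          & lab (v M) (v m) = z].
  move=> z; case zW: (z \in W); last by exists v0.
  by have [w hw] := hW _ zW; exists w.
pose Ext z := [set t in extensions (Bq q) H K M (vs z) | rich_config walk_min t].
have Z0 : 0 < #|Z|%:R :> R by rewrite ltr0n.
have Qr : #|Q|%:R = #|Z|%:R ^+ 2 :> R by rewrite card_Q natrX.
have M0 : (0 < M)%N by move: M_def k_ge2; clear; lia.
(* There are at least [e ^+ a * N ^+ L.+1 / 2] extensions, and at most [e ^+ a.+1 * N ^+ L.+1]
   configurations are poor. *)
have hExt z : z \in W -> e ^+ a.+1 * N ^+ L.+1 <= #|Ext z|%:R.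
  move=> zW; have [cl ed _ _] := hvs z zW.
  have kp i : (i < m)%N -> kept (Bq q) H e K K' (vs z i) (vs z i.+1).
    by move=> hi; have /andP[] := ed i hi.
  have := card_extensions M0 cl kp e_gt0 (ltW K0) N0 K'_le.
  have -> : (e ^+ 2 * N) ^+ m * (K * N ^+ 2) ^+ m = e ^+ a * N ^+ L.+1.
    rewrite -exprMn.
    have -> : e ^+ 2 * N * (K * N ^+ 2) = e ^+ (k + 8) * N ^+ 3.
      have -> : e ^+ (k + 8) = e ^+ 2 * K by rewrite /K -exprD; congr (_ ^+ _); clear; lia.
      by ring.
    rewrite exprMn -!exprM; congr (_ ^+ _ * _ ^+ _); last by clear; lia.
    by rewrite M_def /a; clear; lia.
  have : (#|extensions (Bq q) H K M (vs z)| <= #|Ext z| + #|poor_configs q|)%N.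
    apply: leq_trans (leq_card_setU _ _); apply/subset_leq_card/subsetP => t ht.
    rewrite in_setU [t \in Ext z]inE ht /=; case: (boolP (rich_config walk_min t)) => //= hr.
    rewrite inE hr andbT; apply/pivotsP => j; exact: extension_inner ht _.
  rewrite -(ler_nat R) natrD => h1 h2.
  have : e ^+ a.+1 * N ^+ L.+1 <= e ^+ a * N ^+ L.+1 / 1000.
    rewrite exprS -mulrA [leLHS]mulrC; apply: ler_wpM2l; last by move: e1; lra.
    by rewrite mulr_ge0 ?exprn_ge0 ?ltW.
  have : 0 <= e ^+ a * N ^+ L.+1 by rewrite mulr_ge0 ?exprn_ge0 ?ltW.
  move: hC h1 h2; lra.
(* The exponent is [2 * k + 14] from [hex_min] plus 12 from [D ^ 6], as [D] is at most [e ^- 2]. *)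
pose hex_bound := Num.truncn (e ^- (2 * k + 26)).
have e26 : 0 < e ^+ (2 * k + 26) by apply: exprn_gt0.
have hex_boundP (c : nat) : c%:R * hex_min <= (#|Z| ^ 2 * D ^ 6)%:R -> (c <= hex_bound)%N.
  rewrite /hex_min Qr natrM !natrX => h.
  rewrite truncn_ge_nat; last by rewrite invr_ge0 ltW.
  rewrite -[leRHS]mul1r ler_pdivlMr //.
  have Z2 : 0 < #|Z|%:R ^+ 2 :> R by apply: exprn_gt0.
  have h' : c%:R * e ^+ (2 * k + 14) <= D%:R ^+ 6.
    by rewrite -(ler_pM2r Z2) -mulrA [leRHS]mulrC.
  have -> : e ^+ (2 * k + 26) = e ^+ (2 * k + 14) * (e ^+ 2) ^+ 6.
    by rewrite -exprM -exprD; congr (_ ^+ _); clear; lia.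
  rewrite mulrA; apply: (@le_trans _ _ (D%:R ^+ 6 * (e ^+ 2) ^+ 6)).
    by apply: ler_wpM2r => //; apply/exprn_ge0/exprn_ge0/ltW.
  rewrite -exprMn; apply: exprn_ile1 => //; apply: mulr_ge0 => //.
  exact/exprn_ge0/ltW.
have hcount : #|W|%:R * (e ^+ a.+1 * N ^+ L.+1) <=
    (#|Z| * #|rich_inner_labels walk_min M| * hex_bound ^ m)%:R.
  apply: (@count_completions hex_min walk_min hex_bound M l W vs Ext).
  - by move=> *; apply/hex_boundP/card_rich_labels_last.
  - by move=> *; apply/hex_boundP/card_rich_labels_spoke.
  - by move=> z zW; have [h1 h2 h3 h4] := hvs z zW; split=> //; apply: hExt.
  - move=> z t zW; rewrite inE => /andP[ht hr].
    have [cl ed _ _] := hvs z zW.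
    have ed' i : (i < m)%N -> Bq q (vs z i) (vs z i.+1).
      by move=> hi; have /andP[/okB] := ed i hi.
    split=> //.
    + have := extension_spoke ht 0%N; rewrite /= mod0n => /BqE.
      by rewrite -(inner0 t 0%N) muln0.
    + by move=> j hj; apply: BqE (extension_inner ht hj).
    + by move=> i; apply: extension_rich_hexagon cl ed' ht i.
have hlam := card_rich_inner_labels walk_min M.
have e0 := e_gt0.
have : #|W|%:R * e ^+ (2 * a + 4 + 2 * L.+1 + (2 * k + 26) * m) <= 1.
  apply: (@bound_of_label_counts _ e (#|Z|%:R) N (#|W|%:R) (#|rich_inner_labels walk_min M|%:R)
     D%:R hex_bound%:R) => //.
  - by rewrite card_V ler_nat; clear; lia.
  - rewrite -ler_pdivlMr // mul1r truncn_le invr_ge0 ltW //.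
  - by move: hlam; rewrite /walk_min Qr natrM natrX natrM natrX natrX.
  - by move: hcount; rewrite natrM natrX natrM.
set A := (_ + _ + _ + _)%N => hA.
have eA : 0 < e ^+ A by apply: exprn_gt0.
apply: (@le_trans _ _ (e ^- A)); first by rewrite -[leRHS]mul1r ler_pdivlMr.
rewrite lef_pV2 ?posrE ?exprn_gt0 //.
apply: ler_wiXn2l; [exact: ltW | by move: e1; lra | ].
(* The exponent becomes [8 * k ^ 2 + 96 * k + 4], at most [33 * k ^ 3] for [k >= 2]. *)
rewrite /A /a M_def; have -> : L.+1 = (6 * k)%N by move: M_def; clear; lia.
by move: k_ge2; clear; nia.
Qed.

End Density.
End PivotedGraph.

(** * Sets of cells as bipartite graphs *)

Section BipartiteRelation.
Variables (X Y : finType).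

Definition bip_rel (S : {set X * Y}) : rel (X + Y) := fun v w =>
  match v, w with
  | inl x, inr y => (x, y) \in S
  | inr y, inl x => (x, y) \in S
  | _, _ => false
  end.

Lemma bip_rel_sym S v w : bip_rel S v w = bip_rel S w v.
Proof. by case: v w => [x|y] [x'|y']. Qed.

Lemma card_bip_rel S : #|[set p : (X + Y) * (X + Y) | bip_rel S p.1 p.2]| = (2 * #|S|)%N.
Proof.
pose f (c : X * Y) : (X + Y) * (X + Y) := (inl c.1, inr c.2).
pose g (c : X * Y) : (X + Y) * (X + Y) := (inr c.2, inl c.1).
have f_inj : injective f by move=> [? ?] [? ?] [-> ->].
have g_inj : injective g by move=> [? ?] [? ?] [-> ->].
rewrite mul2n -addnn -{1}(card_imset _ f_inj) -(card_imset _ g_inj).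
rewrite -cardsUI [f @: S :&: g @: S](_ : _ = set0) ?cards0 ?addn0; last first.
  apply/setP=> p; rewrite !inE; apply/negP => /andP[/imsetP[c _ ->]].
  by case/imsetP.
apply: eq_card => -[v w]; rewrite !inE; apply/idP/idP => [|/orP[]/imsetP[[x y] h [-> ->]]] //.
case: v w => [x|y] [x'|y'] //= h; apply/orP; [left|right]; apply/imsetP.
- by exists (x, y').
- by exists (x', y).
Qed.

End BipartiteRelation.

(** * Popular rectangles in a partial Latin square *)

Section PopularRectangles.
Variables (R : realType) (X Y Z : finType) (A : {set X * Y}) (phi : X * Y -> Z).
Variables (e : R) (n : nat).
Hypothesis e_gt0 : 0 < e.
Hypothesis n_gt0 : (0 < n)%N.
Hypothesis cardX : #|X| = n.
Hypothesis cardY : #|Y| = n.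
Hypothesis latin : partial_latin_square A phi.

Definition rectangle (t : X * X * Y * Y) : bool :=
  let: (x, u, y, v) := t in
  [&& (x, y) \in A, (u, y) \in A, (x, v) \in A & (u, v) \in A].

(** [z] and [c] label opposite corners; [a] shares the row of [z] and [b] its column. With the pivot
    at [c], the spokes are labelled [a] and [b]. *)
Definition reps (z a b c : Z) : {set X * X * Y * Y} :=
  [set t | rectangle t && (let: (x, u, y, v) := t in
    [&& phi (x, y) == z, phi (u, y) == a, phi (x, v) == b & phi (u, v) == c])].

Definition popular (z a b c : Z) : bool := e / 2 * n%:R <= #|reps z a b c|%:R.

Definition popular_rectangle (t : X * X * Y * Y) : bool :=
  rectangle t && (let: (x, u, y, v) := t in
    popular (phi (x, y)) (phi (u, y)) (phi (x, v)) (phi (u, v))).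

Let n_gt0r : 0 < n%:R :> R. Proof. by rewrite ltr0n. Qed.

(* Three labels and the column x determine the rectangle: go around it from x. *)
Lemma few_popular (F : Z -> {set X * X * Y * Y}) :
  (forall s t r r', r \in F s -> r' \in F t -> r.1.1.1 = r'.1.1.1 -> s = t /\ r = r') ->
  #|[set t | e / 2 * n%:R <= #|F t|%:R]|%:R <= 2 / e.
Proof.
move=> hF; set W := [set t | _].
have en : 0 < e / 2 * n%:R by rewrite mulr_gt0 // divr_gt0.
rewrite -(ler_pM2r en).
have -> : 2 / e * (e / 2 * n%:R) = n%:R by field; rewrite gt_eqF.
pose S := [set p : Z * (X * X * Y * Y) | p.2 \in F p.1].
have h1 : #|W|%:R * (e / 2 * n%:R) <= #|S|%:R.
  rewrite (card_pairs (fun z t => t \in F z)) natr_sum mulr_natl -sumr_const.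
  rewrite big_mkcond /=; apply: ler_sum => t _; case: ifP => [|_]; last exact: ler0n.
  rewrite inE => h; apply: le_trans h _; rewrite ler_nat.
  by apply/subset_leq_card/subsetP => r; rewrite inE.
apply: le_trans h1 _; rewrite ler_nat -cardX.
have f_inj : {in S &, injective (fun p : Z * (X * X * Y * Y) => p.2.1.1.1)}.
  by move=> [s r] [t r']; rewrite !inE /= => h h' E; have [-> ->] := hF _ _ _ _ h h' E.
by rewrite -(card_in_imset f_inj) max_card.
Qed.

Lemma few_popular_left z b c : #|[set a | popular z a b c]|%:R <= 2 / e.
Proof.
case: latin => lx ly; apply: few_popular => s t [[[x u] y] v] [[[x' u'] y'] v'].
rewrite !inE => /andP[/and4P[a1 a2 a3 a4] /and4P[/eqP b1 /eqP b2 /eqP b3 /eqP b4]].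
move=> /andP[/and4P[c1 c2 c3 c4] /and4P[/eqP d1 /eqP d2 /eqP d3 /eqP d4]] /= ?; subst x'.
have ? : y = y' by apply: (ly x) => //; rewrite b1.
have ? : v = v' by apply: (ly x) => //; rewrite b3.
subst y' v'.
have ? : u = u' by apply: (lx _ _ v) => //; rewrite b4.
by subst u'; rewrite -b2 -d2.
Qed.

Lemma few_popular_right z a c : #|[set b | popular z a b c]|%:R <= 2 / e.
Proof.
case: latin => lx ly; apply: few_popular => s t [[[x u] y] v] [[[x' u'] y'] v'].
rewrite !inE => /andP[/and4P[a1 a2 a3 a4] /and4P[/eqP b1 /eqP b2 /eqP b3 /eqP b4]].
move=> /andP[/and4P[c1 c2 c3 c4] /and4P[/eqP d1 /eqP d2 /eqP d3 /eqP d4]] /= ?; subst x'.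
have ? : y = y' by apply: (ly x) => //; rewrite b1.
subst y'.
have ? : u = u' by apply: (lx _ _ y) => //; rewrite b2.
subst u'.
have ? : v = v' by apply: (ly u) => //; rewrite b4.
by subst v'; rewrite -b3 -d3.
Qed.

Lemma few_popular_label a b c : #|[set z | popular z a b c]|%:R <= 2 / e.
Proof.
case: latin => lx ly; apply: few_popular => s t [[[x u] y] v] [[[x' u'] y'] v'].
rewrite !inE => /andP[/and4P[a1 a2 a3 a4] /and4P[/eqP b1 /eqP b2 /eqP b3 /eqP b4]].
move=> /andP[/and4P[c1 c2 c3 c4] /and4P[/eqP d1 /eqP d2 /eqP d3 /eqP d4]] /= ?; subst x'.
have ? : v = v' by apply: (ly x) => //; rewrite b3.
subst v'.
have ? : u = u' by apply: (lx _ _ v) => //; rewrite b4.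
subst u'.
have ? : y = y' by apply: (ly u) => //; rewrite b2.
by subst y'; rewrite -b1 -d1.
Qed.

Lemma card_reps z a b c : (#|reps z a b c| <= n)%N.
Proof.
case: latin => lx ly; rewrite -cardX.
have f_inj : {in reps z a b c &, injective (fun t : X * X * Y * Y => t.1.1.1)}.
  move=> [[[x u] y] v] [[[x' u'] y'] v'].
  rewrite !inE => /andP[/and4P[a1 a2 a3 a4] /and4P[/eqP b1 /eqP b2 /eqP b3 /eqP b4]].
  move=> /andP[/and4P[c1 c2 c3 c4] /and4P[/eqP d1 /eqP d2 /eqP d3 /eqP d4]] /= ?; subst x'.
  have ? : y = y' by apply: (ly x) => //; rewrite b1.
  have ? : v = v' by apply: (ly x) => //; rewrite b3.
  subst y' v'.
  by have -> : u = u' by apply: (lx _ _ v) => //; rewrite b4.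
by rewrite -(card_in_imset f_inj) max_card.
Qed.

(** An octahedron is a pair of rectangles with equal labels. A popular rectangle has at most [n]
    partners and an unpopular one fewer than [e / 2 * n], so the unpopular ones account for at most
    half of the octahedra required. *)
Lemma card_popular_rectangles : e * n%:R ^+ 5 <= #|octahedra A phi|%:R ->
  e / 2 * n%:R ^+ 4 <= #|[set t | popular_rectangle t]|%:R.
Proof.
move=> hoct.
pose F (t : X * X * Y * Y) := let: (x, u, y, v) := t in
  reps (phi (x, y)) (phi (u, y)) (phi (x, v)) (phi (u, v)).
have h1 : (#|octahedra A phi| <= \sum_t #|[set t' | rectangle t && (t' \in F t)]|)%N.
  rewrite -(card_pairs (fun t t' => rectangle t && (t' \in F t))).
  pose f (t : X * X * Y * Y * X * X * Y * Y) := let: (x1, x2, y1, y2, x3, x4, y3, y4) := t in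
    ((x1, x2, y1, y2), (x3, x4, y3, y4)).
  have f_inj : injective f.
    move=> [[[[[[[? ?] ?] ?] ?] ?] ?] ?] [[[[[[[? ?] ?] ?] ?] ?] ?] ?].
    by move=> [-> -> -> -> -> -> -> ->].
  rewrite -(card_imset _ f_inj); apply/subset_leq_card/subsetP => _ /imsetP[t + ->].
  case: t => [[[[[[[x1 x2] y1] y2] x3] x4] y3] y4].
  rewrite !inE /= => /and5P[-> -> -> -> /and5P[-> -> -> -> /and4P[/eqP-> /eqP-> /eqP-> /eqP->]]].
  by rewrite !eqxx.
have h2 : (\sum_t #|[set t' | rectangle t && (t' \in F t)]|)%:R <=
    \sum_(t : X * X * Y * Y) ((popular_rectangle t)%:R * n%:R + e / 2 * n%:R).
  rewrite natr_sum; apply: ler_sum => t _.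
  have en : 0 <= e / 2 * n%:R by rewrite mulr_ge0 // divr_ge0 // ltW.
  rewrite /popular_rectangle; case: (rectangle t) => /=; last first.
    rewrite (_ : [set _ | _] = set0); last by apply/setP => t'; rewrite !inE.
    by rewrite cards0 mul0r add0r.
  rewrite (_ : [set _ | _] = F t); last by apply/setP => t'; rewrite inE.
  case: t => [[[x u] y] v] /=.
  case: (boolP (popular _ _ _ _)) => [_|]; last by rewrite -ltNge mul0r add0r => /ltW.
  rewrite mul1r -[leLHS]addr0; apply: lerD => //.
  by rewrite ler_nat card_reps.
have := le_trans hoct (le_trans _ h2); rewrite ler_nat h1 => /(_ isT).
have -> : \sum_(t : X * X * Y * Y) ((popular_rectangle t)%:R * n%:R + e / 2 * n%:R) =
    #|[set t | popular_rectangle t]|%:R * n%:R + e / 2 * n%:R ^+ 4 * n%:R.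
  rewrite big_split /= -mulr_suml; congr (_ * _ + _).
    rewrite -natr_sum -sum1_card [in RHS]big_mkcond /=; congr (_%:R).
    by apply: eq_bigr => t _; rewrite inE; case: (popular_rectangle t).
  by rewrite sumr_const -[LHS]mulr_natr !card_prod cardX cardY !natrM; ring.
have -> : e * n%:R ^+ 5 = e / 2 * n%:R ^+ 4 * n%:R + e / 2 * n%:R ^+ 4 * n%:R by field.
by rewrite lerD2r ler_pM2r.
Qed.

End PopularRectangles.

(** * The pivoted graph of a partial Latin square *)

Section LatinSquareGraph.
Variables (R : realType) (X Y Z : finType) (A : {set X * Y}) (phi : X * Y -> Z).
Variables (e : R) (n k : nat).
Hypothesis e_gt0 : 0 < e.
Hypothesis e_lt : e < 10 ^- 3.
Hypothesis k_ge2 : (2 <= k)%N.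
Hypothesis n_gt0 : (0 < n)%N.
Hypothesis cardX : #|X| = n.
Hypothesis cardY : #|Y| = n.
Hypothesis cardZ : #|Z| = n.
Hypothesis latin : partial_latin_square A phi.
Hypothesis many_octahedra : e * n%:R ^+ 5 <= #|octahedra A phi|%:R.

Let V := (X + Y)%type.

(* [z0] is a junk value, on pairs that are not joined by a cell. *)
Definition cell_label (z0 : Z) (v w : X + Y) : Z :=
  match v, w with
  | inl x, inr y => phi (x, y)
  | inr y, inl x => phi (x, y)
  | _, _ => z0
  end.

Definition pivot_cells (q : X * Y) : {set X * Y} :=
  [set c | popular_rectangle A phi e n (c.1, q.1, c.2, q.2)].

Definition spoke_label (q : X * Y) (v : X + Y) : Z :=
  match v with inl x => phi (x, q.2) | inr y => phi (q.1, y) end.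

(* Either orientation of the edge is allowed, which only doubles the bounds. *)
Definition popular_step (c z s t : Z) : bool :=
  popular A phi e n z t s c || popular A phi e n z s t c.

Definition step_bound : nat := 2 * Num.truncn (2 / e).

Lemma card_popular_step_end c z s :
  (#|[set t | popular_step c z s t]| <= step_bound)%N.
Proof.
rewrite /popular_step (_ : [set _ | _] =
  [set t | popular A phi e n z t s c] :|: [set t | popular A phi e n z s t c]); last first.
  by apply/setP => t; rewrite !inE.
apply: leq_trans (leq_card_setU _ _) _; rewrite /step_bound mul2n -addnn.
have e2 : 0 <= 2 / e by rewrite divr_ge0 // ltW.
apply: leq_add; rewrite truncn_ge_nat //.
  exact: few_popular_left.
exact: few_popular_right.
Qed.

Lemma card_popular_step_label c s t :
  (#|[set z | popular_step c z s t]| <= step_bound)%N.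
Proof.
rewrite /popular_step (_ : [set _ | _] =
  [set z | popular A phi e n z t s c] :|: [set z | popular A phi e n z s t c]); last first.
  by apply/setP => z; rewrite !inE.
apply: leq_trans (leq_card_setU _ _) _; rewrite /step_bound mul2n -addnn.
have e2 : 0 <= 2 / e by rewrite divr_ge0 // ltW.
by apply: leq_add; rewrite truncn_ge_nat //; apply: few_popular_label.
Qed.

Lemma step_bound_le : step_bound%:R * e ^+ 2 <= 1.
Proof.
have e1 := e_small e_lt.
have : (Num.truncn (2 / e))%:R <= 2 / e by rewrite truncn_le divr_ge0 // ltW.
rewrite ler_pdivlMr // => h; rewrite /step_bound natrM.
have -> : 2 * (Num.truncn (2 / e))%:R * e ^+ 2 = 2 * e * ((Num.truncn (2 / e))%:R * e) by ring.
by move: h; move: ((Num.truncn (2 / e))%:R * e) => u h; move: e_gt0 e1; nra.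
Qed.

(** A pivot with one of its cells is a popular rectangle. Each cell gives two ordered edges and
    there are [2 * n] vertices, so both sides scale to [e * n ^+ 4]. *)
Lemma pivot_cells_dense : e / 4 * #|{: X * Y}|%:R * #|{: X + Y}|%:R ^+ 2 <=
  \sum_(q : X * Y) #|[set p : V * V | bip_rel (pivot_cells q) p.1 p.2]|%:R.
Proof.
rewrite card_prod card_sum cardX cardY.
under eq_bigr do rewrite card_bip_rel natrM.
rewrite -mulr_sumr -natr_sum.
have -> : (\sum_q #|pivot_cells q| = #|[set t | popular_rectangle A phi e n t]|)%N.
  rewrite /pivot_cells -(card_pairs (fun q c : X * Y =>
    popular_rectangle A phi e n (c.1, q.1, c.2, q.2))).
  pose f (p : (X * Y) * (X * Y)) := (p.2.1, p.1.1, p.2.2, p.1.2).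
  have f_inj : injective f by move=> [[? ?] [? ?]] [[? ?] [? ?]] [-> -> -> ->].
  rewrite -(card_imset _ f_inj); apply: eq_card => -[[[x u] y] v]; rewrite inE.
  apply/imsetP/idP => [[[[u' v'] [x' y']]]|h].
    by rewrite inE /= => h [-> -> -> ->].
  by exists ((u, v), (x, y)) => //; rewrite inE.
have := card_popular_rectangles e_gt0 n_gt0 cardX cardY latin many_octahedra.
rewrite natrM natrD => h.
have -> : e / 4 * (n%:R * n%:R) * (n%:R + n%:R) ^+ 2 = 2 * (e / 2 * n%:R ^+ 4) by field.
by rewrite ler_pM2l.
Qed.

Lemma latin_square_bounded_completions (z0 : Z) : exists B : {set X * Y},
  [/\ B \subset A, e / 8 * n%:R ^+ 2 <= #|B|%:R
    & forall (l : nat -> Z) (W : {set Z}),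
      (forall z, z \in W -> exists v : nat -> X + Y,
        [/\ v (2 * k)%N = v 0%N, forall i, (i < 2 * k)%N -> bip_rel B (v i) (v i.+1),
            forall i, (i < (2 * k).-1)%N -> cell_label z0 (v i) (v i.+1) = l i
          & cell_label z0 (v (2 * k).-1) (v (2 * k)%N) = z]) ->
      #|W|%:R <= e ^- (33 * k ^ 3)].
Proof.
case: (latin) => lx ly.
have Mdef : (2 * k).-1.+1 = (2 * k)%N by move: k_ge2; clear; lia.
have [|||||||||B [Bsym BE cardB hB]] :=
  @exists_bounded_completions R V Z (X * Y)%type (cell_label z0)
  (bip_rel A) (fun q => bip_rel (pivot_cells q)) spoke_label phi popular_step step_bound
  _ _ _ _ _ card_popular_step_end card_popular_step_label _ e k (2 * k).-1 e_gt0 e_lt k_ge2 Mdef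
  _ _ _ step_bound_le pivot_cells_dense.
- by case=> [x|y] [x'|y'].
- case=> [x|y] [x'|y'] [x''|y''] //= h1 h2 h3; congr (_ _).
    exact: ly h1 h2 h3.
  exact: lx h1 h2 h3.
- by move=> q [x|y] [x'|y'] //=; rewrite !inE => /andP[/and4P[]].
- by move=> q; apply: bip_rel_sym.
- move=> [u v] [x|y] [x'|y'] //=; rewrite inE /popular_step => /andP[_ /= ->] //.
  by rewrite orbT.
(* At a column [x] the spoke label determines the row [v] of the pivot, and then the pivot's label
   determines its column [u]; at a row the roles are exchanged. *)
- move=> [u v] [u' v'] [x|y] [x'|y'] [x''|y''] //=; rewrite !inE.
    move=> /andP[/and4P[a1 a2 a3 a4] _] /andP[/and4P[b1 b2 b3 b4] _] h1 h2.
    have ev : v = v' := ly _ _ _ a3 b3 h2; subst v'.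
    by congr (_, _); apply: lx a4 b4 h1.
  move=> /andP[/and4P[a1 a2 a3 a4] _] /andP[/and4P[b1 b2 b3 b4] _] h1 h2.
  have eu : u = u' := lx _ _ _ a2 b2 h2; subst u'.
  by congr (_, _); apply: ly a4 b4 h1.
- by rewrite cardZ.
- by rewrite card_sum cardX cardY cardZ addnn mul2n.
- by rewrite card_prod cardX cardY cardZ expnS expn1.
pose S := [set c : X * Y | B (inl c.1) (inr c.2)].
have BS v w : B v w = bip_rel S v w.
  case: v w => [x|y] [x'|y'] /=.
  - by apply/negbTE/negP => /BE.
  - by rewrite inE.
  - by rewrite inE Bsym.
  - by apply/negbTE/negP => /BE.
exists S; split.
- by apply/subsetP => -[x y]; rewrite inE => /BE.
- move: cardB; rewrite (_ : [set _ | _] = [set p : V * V | bip_rel S p.1 p.2]); last first.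
    by apply/setP => p; rewrite !inE BS.
  rewrite card_bip_rel card_sum cardX cardY natrM natrD.
  have -> : e / 16 * (n%:R + n%:R) ^+ 2 = 2 * (e / 8 * n%:R ^+ 2) by field.
  by rewrite ler_pM2l.
move=> l W hW; apply: (hB l W) => z /hW [v [h1 h2 h3 h4]]; exists v; rewrite Mdef.
by split=> // i hi; rewrite BS; apply: h2.
Qed.

End LatinSquareGraph.

(** * From cycles of cells to closed walks of a fixed length *)

(* The first cell is repeated [s] times (the subtraction is truncated at 0), which
   turns [2r]-cycles into [2k]-cycles and reduces the theorem to [r = k]. *)
Lemma cycle_walk (X Y : finType) (B : {set X * Y}) (r s : nat)
    (p : (2 * r).-tuple (X * Y)) (c0 : X * Y) : (0 < r)%N -> is_cycle B p -> ~~ odd s ->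
  let c j := nth c0 p ((j - s) %% (2 * r))%N in
  let v j : X + Y := if odd j then inr (c j).2 else inl (c j).1 in
  v (s + 2 * r)%N = v 0%N /\ forall j, (j < s + 2 * r)%N ->
    c j \in B /\ (v j, v j.+1) =
      (if odd j then (inr (c j).2, inl (c j).1) else (inl (c j).1, inr (c j).2)).
Proof.
move=> r0 /forallP hp os c v.
have r2 : (0 < 2 * r)%N by rewrite muln_gt0.
have hc i : (i < 2 * r)%N -> let d i := nth c0 p (i %% (2 * r))%N in
    d i \in B /\ (if odd i then (d i).1 == (d i.+1).1 else (d i).2 == (d i.+1).2).
  move=> hi /=; have /andP[] := hp (Ordinal hi).
  by rewrite !(tnth_nth c0) /= (modn_small hi).
split.
  rewrite /v /c oddD oddM /= (negPf os) /= addKn modnn sub0n mod0n //.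
move=> j hj.
have hjs : (j - s < 2 * r)%N by move: hj r2; clear; lia.
have [h1 h2] := hc _ hjs; split=> //.
have odd_js : (s <= j)%N -> odd (j - s) = odd j by move=> h; rewrite oddB // (negPf os) addbF.
case: (leqP s j) => hsj.
  move: h2; rewrite -subSn // odd_js // /v /= -/(c j) -/(c j.+1).
  by case: (odd j) => /= /eqP->.
(* During the padding [j < s], both truncated differences vanish and the walk goes back and forth
   along the first cell; as [s] is even, the cycle then starts from the column end. *)
have -> : v j.+1 = (if odd j then inl (c j).1 else inr (c j).2).
  rewrite /v /c /=; have -> : (j.+1 - s = 0)%N by move: hsj; clear; lia.
  have -> : (j - s = 0)%N by move: hsj; clear; lia.
  by case: (odd j).
by rewrite /v; case: (odd j).
Qed.

Theorem theorem2p2 (R : realType) (eps : R) (k n : nat) (X Y Z : finType)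
    (A : {set X * Y}) (phi : X * Y -> Z)
    (eps_gt0 : 0 < eps) (eps_lt : eps < 10 ^- 3) (k_ge2 : (2 <= k)%N)
    (cardX : #|X| = n) (cardY : #|Y| = n) (cardZ : #|Z| = n)
    (hA : partial_latin_square A phi)
    (hoct : eps * n%:R ^+ 5 <= #|octahedra A phi|%:R) :
  exists (B : {set X * Y}) (beta : R),
    [/\ B \subset A,
        #|B|%:R = beta * n%:R ^+ 2,
        eps ^+ 10 <= beta
      & forall r : nat, (2 <= r <= k)%N ->
          completion_well_defined phi B r (eps ^- (33 * k ^ 3))].
Proof.
have e1 := e_small eps_lt.
have C0 : 0 <= eps ^- (33 * k ^ 3) by rewrite invr_ge0 exprn_ge0 // ltW.
have [n0|n_gt0] := posnP n.
  (* There are no cells, so any [beta] satisfies the cardinality equation; the least allowed value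
     is taken. *)
  exists set0, (eps ^+ 10); split=> //; first exact: sub0set.
    by rewrite cards0 n0 expr0n mulr0.
  move=> r _ z; suff -> : cycle_completions phi set0 z = set0 by rewrite cards0.
  by apply/setP => w; have := max_card (pred1 w); rewrite card1 cardZ n0.
have /card_gt0P [x0 _] : (0 < #|X|)%N by rewrite cardX.
have /card_gt0P [y0 _] : (0 < #|Y|)%N by rewrite cardY.
pose z0 := phi (x0, y0).
have nr : 0 < n%:R ^+ 2 :> R by rewrite exprn_gt0 // ltr0n.
have [B [BA cardB hB]] := latin_square_bounded_completions eps_gt0 eps_lt k_ge2
   n_gt0 cardX cardY cardZ hA hoct z0.
exists B, (#|B|%:R / n%:R ^+ 2); split=> //.
- by rewrite divfK // gt_eqF.
- rewrite ler_pdivlMr //; apply: le_trans cardB; apply: ler_wpM2r; first exact: ltW.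
  (* The density obtained is [eps / 8], well above [eps ^+ 2]. *)
  apply: (@le_trans _ _ (eps ^+ 2)).
    by apply: ler_wiXn2l => //; [exact: ltW | move: e1; lra].
  by rewrite expr2; move: eps_gt0 e1; nra.
move=> r /andP[r2 rk] z.
pose s := (2 * (k - r))%N.
have r_gt0 : (0 < r)%N by apply: leq_trans r2.
have sr : (s + 2 * r = 2 * k)%N by rewrite /s -mulnDr subnK.
(* The prescribed labels are those of the padded walk: the truncated difference repeats the first
   label of [z] during the padding, and [w] falls on the last index [2 * k - 1]. *)
apply: (hB (fun j => nth z0 z (j - s)%N)) => w; rewrite inE => /existsP[p /andP[cp /eqP lp]].
have os : ~~ odd s by rewrite /s oddM.
pose c j := nth (x0, y0) p ((j - s) %% (2 * r))%N.
pose v j : X + Y := if odd j then inr (c j).2 else inl (c j).1.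
have [vcl hv] : v (s + 2 * r)%N = v 0%N /\ forall j, (j < s + 2 * r)%N ->
    c j \in B /\ (v j, v j.+1) =
      (if odd j then (inr (c j).2, inl (c j).1) else (inl (c j).1, inr (c j).2)).
  exact: cycle_walk.
rewrite sr in vcl hv.
have lab_v j : (j < 2 * k)%N -> cell_label phi z0 (v j) (v j.+1) = phi (c j).
  move=> /hv[_]; move: (v j) (v j.+1) => vj vj'.
  by case: (odd j) => -[-> ->] /=; case: (c j).
have phi_c j : (j < 2 * k)%N -> phi (c j) = nth z0 (rcons z w) (j - s).
  move=> hj; have hjs : (j - s < 2 * r)%N by move: hj sr r_gt0; clear; lia.
  by rewrite -lp (nth_map (x0, y0)) ?size_tuple // /c modn_small.
have kp : ((2 * k).-1.+1 = 2 * k)%N by move: k_ge2; clear; lia.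
exists v; split=> //.
- move=> i hi; have [cB] := hv i hi; move: (v i) (v i.+1) => vi vi'.
  by case: (odd i) => -[-> ->] /=; move: cB; case: (c i).
- move=> i hi; have hi2 : (i < 2 * k)%N by move: hi; clear; lia.
  rewrite lab_v // phi_c // nth_rcons size_tuple.
  by rewrite (_ : (i - s < (2 * r).-1)%N) //; move: hi sr r_gt0; clear; lia.
rewrite -{2}kp lab_v ?kp // phi_c ?kp // nth_rcons size_tuple.
have -> : ((2 * k).-1 - s = (2 * r).-1)%N by move: sr r_gt0; clear; lia.
by rewrite ltnn eqxx.
Qed.
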